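(* Consider the two-dimensional regular lattice with the exponential-family testing problem (see context) with parameters $\theta_m>0$ and minimax risk $\gamma$. (i) If $\theta_m\sqrt{\log m}\to\infty$, there is a sequence of tests with $\gamma(T_m)\to0$. (ii) If $\theta_m\log m\sqrt{\log\log m}\to0$, every sequence of tests satisfies $\liminf_m\gamma(T_m)\ge1$.
   Context: Regular lattice: $V_m=\{(i,j)\in\mathbb{Z}^2: 0\le i\le m-1,\ -i\le j\le i,\ j\equiv i \pmod 2\}$ with oriented edges $(i,j)\to(i+1,j\pm1)$; $\mathcal{P}_m$ is the set of paths from the origin $(0,0)$ visiting $m$ vertices: $(i,p_i)_{0\le i\le m-1}$, $p_0=0$, $|p_{i+1}-p_i|=1$. Exponential family: $F_0$ is a nondegenerate distribution on $\mathbb{R}$ with $\varphi(\theta)=\mathbf{E}_{F_0}e^{\theta X}<\infty$ for $\theta$ in a neighborhood of $0$; $F_\theta$ is the distribution with density $\exp(\theta x-\log\varphi(\theta))$ with respect to $F_0$. Under $H_0$ (law $\mathbf{P}_0$) the $X_v$ are i.i.d. $F_0$; under $H_{1,m}$ with unknown path $p\in\mathcal{P}_m$ (law $\mathbf{P}_{1,p}$) the $X_v$ are independent, with law $F_{\theta_m}$ on $p$ and $F_0$ off $p$. A test is a measurable $\{0,1\}$-valued function of $(X_v)$; minimax risk $\gamma(T_m)=\mathbf{P}_0(T_m=1)+\sup_{p\in\mathcal{P}_m}\mathbf{P}_{1,p}(T_m=0)$. *)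

(* Defs.v *)
From HB Require Import structures.
From mathcomp Require Import all_boot all_order all_algebra.
From mathcomp Require Import all_classical all_reals all_analysis.
Set Implicit Arguments. Unset Strict Implicit. Unset Printing Implicit Defensive.
Import Order.TTheory GRing.Theory Num.Theory.
Local Open Scope classical_set_scope.
Local Open Scope ring_scope.

Section Defs.
Variable R : realType.

(** The vertex set V_m of the regular lattice, as the explicit list of its
    elements (i, j) : nat * int, obtained by filtering a bounding box with the
    defining predicate  0 <= i <= m-1, -i <= j <= i, j = i (mod 2). *)
Definition in_V (m : nat) (v : nat * int) : bool :=
  [&& (v.1 < m)%N, - (v.1%:Z) <= v.2, v.2 <= v.1%:Z & ((v.2 - v.1%:Z) %% 2)%Z == 0].

Definition Vlist (m : nat) : seq (nat * int) :=
  [seq v <- [seq (i, j%:Z - m%:Z) | i <- iota 0 m, j <- iota 0 (2 * m)] | in_V m v].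

(** number of vertices; the observation vector is a tuple of that length,
    coordinate k being X_v for v = nth (0,0) (Vlist m) k. *)
Definition nV (m : nat) : nat := size (Vlist m).
Definition vert (m k : nat) : nat * int := nth (0%N, 0) (Vlist m) k.

(** P_m : paths from the origin visiting m vertices (i, p i), 0 <= i <= m-1. *)
Definition is_path (m : nat) (p : nat -> int) : Prop :=
  p 0%N = 0 /\ forall i : nat, (i.+1 < m)%N -> `|p i.+1 - p i| = 1.

Definition on_path (p : nat -> int) (v : nat * int) : bool := v.2 == p v.1.

Definition mgf (F0 : probability R R) (t : R) : \bar R :=
  (\int[F0]_x (expR (t * x))%:E)%E.

Definition Ftheta (F0 : probability R R) (t : R) : set R -> \bar R :=
  fun A => (\int[F0]_(x in A) (expR (t * x - ln (fine (mgf F0 t))))%:E)%E.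

(** Expectation of f (X_0, ..., X_{n-1}) when the X_k are independent with
    laws mu k: the integral against the product measure, computed as an
    iterated integral (Fubini-Tonelli). *)
Fixpoint iint (n : nat) : (nat -> set R -> \bar R) -> (n.-tuple R -> \bar R) -> \bar R :=
  match n return (nat -> set R -> \bar R) -> (n.-tuple R -> \bar R) -> \bar R with
  | 0%N => fun mu f => f [tuple]
  | n'.+1 => fun mu f =>
      (\int[mu 0%N]_x iint (fun i => mu i.+1) (fun t : n'.-tuple R => f (cons_tuple x t)))%E
  end.

Definition law0 (F0 : probability R R) : nat -> set R -> \bar R := fun _ => F0.
Definition law1 (F0 : probability R R) (m : nat) (t : R) (p : nat -> int)
  : nat -> set R -> \bar R :=
  fun k => if on_path p (vert m k) then Ftheta F0 t else (F0 : set R -> \bar R).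

Definition is_test (m : nat) (T : (nV m).-tuple R -> bool) : Prop :=
  measurable_fun setT T.

Definition ind (b : bool) : \bar R := (b%:R)%:E.

Definition risk (F0 : probability R R) (m : nat) (t : R)
  (T : (nV m).-tuple R -> bool) : \bar R :=
  (iint (law0 F0) (fun x => ind (T x)) +
   ereal_sup [set iint (law1 F0 m t p) (fun x => ind (~~ T x)) | p in is_path m])%E.

End Defs.

(* Main.v *)
Require Import Defs.
From HB Require Import structures.
From mathcomp Require Import all_boot all_order all_algebra.
From mathcomp Require Import all_classical all_reals all_analysis.
From mathcomp Require Import measurable_realfun.
From mathcomp Require Import ring lra zify.
Set Implicit Arguments.
Unset Strict Implicit.
Unset Printing Implicit Defensive.
Import Order.TTheory GRing.Theory Num.Theory.
Local Open Scope classical_set_scope.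
Local Open Scope ring_scope.

(** For part (i), reduce each observation to the indicator of [X_v > c], whose
    mean is p under F_0 and exceeds p by at least a constant times
    theta / (1 + theta) under F_theta, and sum over the vertices with weight
    1 / (i + 1) at level i.  Every path collects total weight H_m ~ log m,
    while the variance is at most 2 H_m whatever the path, so Chebyshev's
    inequality applies.

    For part (ii), put a prior on paths and bound the second moment of the
    averaged likelihood ratio, which is the mean of (1 + l)^N with N the number
    of meetings of two independent paths and l = O(theta^2).  The prior is an
    unpredictable random walk: step k belongs to class c = k mod L, with
    L ~ log_2 m; within a class, time is cut into blocks of 2^c steps, and in
    each block the first u steps go up and the others down, with u uniform and
    independent over blocks.  Any k consecutive steps contain a whole block with
    at least k / (4 L) steps, so given the past the position k steps later is at
    any fixed point with probability at most 4 L / k.  Expanding (1 + l)^N over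
    the last meeting gives the bound 1 / (1 - l A) with
    A = 1 + sum_k 4 L / k = O(log^2 m), hence l A -> 0. *)

(** * Iterated integrals and densities *)

Section IteratedIntegral.
Context {R : realType}.
Implicit Types mu : nat -> probability R R.

Notation raw mu := (fun k => mu k : set R -> \bar R).

Lemma iint_ge0 (n : nat) mu (f : n.-tuple R -> \bar R) :
  (forall t, 0 <= f t)%E -> (0 <= iint (raw mu) f)%E.
Proof.
elim: n mu f => [|n IHn] mu f f0 //=.
by apply: integral_ge0 => x _; apply: (IHn (fun k => mu k.+1)) => t.
Qed.

(** The parameter space [T] is arbitrary so that the induction can move the first coordinate into
    it, passing to [T * R]; Tonelli then gives measurability of the outer integral. *)
Lemma measurable_iint (n : nat) mu (d : measure_display) (T : measurableType d)
    (f : T * n.-tuple R -> \bar R) :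
  measurable_fun setT f -> (forall z, 0 <= f z)%E ->
  measurable_fun setT (fun x => iint (raw mu) (fun t => f (x, t))).
Proof.
elim: n mu d T f => [|n IHn] mu d T f mf f0 /=.
  exact: (measurableT_comp mf).
pose h (z : T * R) : \bar R :=
  iint (raw (fun k => mu k.+1)) (fun t => f (z.1, cons_tuple z.2 t)).
suff mh : measurable_fun setT h.
  have h0 z : (0 <= h z)%E by rewrite /h; apply: (iint_ge0 (fun k => mu k.+1)) => t.
  exact: (measurable_fun_fubini_tonelli_F (m2 := mu 0%N) h mh h0).
apply: (IHn (fun k => mu k.+1) _ _ (fun z : (T * R) * n.-tuple R =>
   f (z.1.1, cons_tuple z.1.2 z.2))) => //.
apply: (measurableT_comp mf).
apply: measurable_fun_pair.
  exact: (measurableT_comp measurable_fst measurable_fst).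
apply: measurable_cons; last exact: measurable_snd.
exact: (measurableT_comp measurable_snd measurable_fst).
Qed.

Lemma measurable_iint_cons (n : nat) mu (f : n.+1.-tuple R -> \bar R) :
  measurable_fun setT f -> (forall t, 0 <= f t)%E ->
  measurable_fun setT
    (fun x => iint (raw mu) (fun t : n.-tuple R => f (cons_tuple x t))).
Proof.
move=> mf f0.
apply: (@measurable_iint n mu _ _ (fun z => f (cons_tuple z.1 z.2))) => //.
apply: (measurableT_comp mf); exact: measurable_cons.
Qed.

Lemma measurable_tuple_tail (n : nat) (x : R) (f : n.+1.-tuple R -> \bar R) :
  measurable_fun setT f ->
  measurable_fun setT (fun t : n.-tuple R => f (cons_tuple x t)).
Proof. by move=> mf; apply: (measurableT_comp mf); exact: measurable_cons. Qed.

Lemma eq_iint (n : nat) (mu nu : nat -> set R -> \bar R) (f g : n.-tuple R -> \bar R) :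
  (forall k, (k < n)%N -> mu k = nu k) -> f =1 g -> iint mu f = iint nu g.
Proof.
elim: n mu nu f g => [|n IHn] mu nu f g munu fg /=; first exact: fg.
rewrite munu//; congr (integral _ _ _); apply/funext => x.
by apply: IHn => [k kn|t]; [exact: munu|exact: fg].
Qed.

Lemma iintD (n : nat) mu (f g : n.-tuple R -> \bar R) :
  measurable_fun setT f -> (forall t, 0 <= f t)%E ->
  measurable_fun setT g -> (forall t, 0 <= g t)%E ->
  (iint (raw mu) (fun t => f t + g t) = iint (raw mu) f + iint (raw mu) g)%E.
Proof.
elim: n mu f g => [|n IHn] mu f g mf f0 mg g0 //=.
rewrite -ge0_integralD//; last 4 first.
- by move=> x _; exact: (iint_ge0 (fun k => mu k.+1)).
- exact: (@measurable_iint_cons n (fun k => mu k.+1)).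
- by move=> x _; exact: (iint_ge0 (fun k => mu k.+1)).
- exact: (@measurable_iint_cons n (fun k => mu k.+1)).
apply: eq_integral => x _; apply: (IHn (fun k => mu k.+1)) => //.
- exact: measurable_tuple_tail.
- exact: measurable_tuple_tail.
Qed.

Lemma iintZl (n : nat) mu (k : \bar R) (f : n.-tuple R -> \bar R) :
  (0 <= k)%E -> measurable_fun setT f -> (forall t, 0 <= f t)%E ->
  (iint (raw mu) (fun t => k * f t) = k * iint (raw mu) f)%E.
Proof.
move=> k0; elim: n mu f => [|n IHn] mu f mf f0 //=.
rewrite -ge0_integralZl//; last 2 first.
- exact: (@measurable_iint_cons n (fun k => mu k.+1)).
- by move=> x _; exact: (iint_ge0 (fun k => mu k.+1)).
apply: eq_integral => x _; apply: (IHn (fun k => mu k.+1)) => //.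
exact: measurable_tuple_tail.
Qed.

Lemma iint_cst (n : nat) mu (k : \bar R) :
  (0 <= k)%E -> iint (n := n) (raw mu) (fun=> k) = k.
Proof.
move=> k0; elim: n mu => [|n IHn] mu //=.
under eq_integral do rewrite (IHn (fun k => mu k.+1)).
by rewrite integral_cst//= [X in (_ * X)%E](probability_setT (mu 0%N)) mule1.
Qed.

Lemma le_iint (n : nat) mu (f g : n.-tuple R -> \bar R) :
  measurable_fun setT f -> (forall t, 0 <= f t)%E ->
  measurable_fun setT g -> (forall t, f t <= g t)%E ->
  (iint (raw mu) f <= iint (raw mu) g)%E.
Proof.
elim: n mu f g => [|n IHn] mu f g mf f0 mg fg //=.
have g0 t : (0 <= g t)%E by exact: le_trans (fg t).
apply: ge0_le_integral => //.
- by move=> x _; exact: (iint_ge0 (fun k => mu k.+1)).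
- exact: (@measurable_iint_cons n (fun k => mu k.+1)).
- exact: (@measurable_iint_cons n (fun k => mu k.+1)).
by move=> x _; apply: (IHn (fun k => mu k.+1)) => //; exact: measurable_tuple_tail.
Qed.

Lemma iint_sum (n : nat) mu (I : Type) (s : seq I) (f : I -> n.-tuple R -> \bar R) :
  (forall i, measurable_fun setT (f i)) -> (forall i t, 0 <= f i t)%E ->
  (iint (raw mu) (fun t => \sum_(i <- s) f i t) = \sum_(i <- s) iint (raw mu) (f i))%E.
Proof.
move=> mf f0; elim: s => [|i s IHs].
  rewrite big_nil -[RHS](@iint_cst n mu 0%E)//.
  by apply: eq_iint => // t; rewrite big_nil.
rewrite big_cons -IHs -iintD//.
- by apply: eq_iint => // t; rewrite big_cons.
- exact: emeasurable_sum.
- by move=> t; exact: sume_ge0.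
Qed.

Lemma measurable_prod_tnth (n : nat) (g : nat -> R -> \bar R) :
  (forall k, measurable_fun setT (g k)) ->
  measurable_fun setT (fun t : n.-tuple R => \prod_(k < n) g k (tnth t k))%E.
Proof.
move=> mg.
elim: n g mg => [|n IHn] g mg.
  by under eq_fun do rewrite big_ord0; exact: measurable_cst.
under eq_fun do rewrite big_ord_recl.
apply: emeasurable_funM.
  exact: (measurableT_comp (mg _) (measurable_tnth _)).
rewrite (_ : (fun t => _) = (fun t => \prod_(k < n) g k.+1 (tnth t k))%E \o
   (fun t : n.+1.-tuple R => [tuple of behead t])); last first.
  apply/funext => t /=; apply: eq_bigr => k _.
  by rewrite [in LHS](tuple_eta t) tnthS.
apply: measurableT_comp; first exact: (IHn (fun k => g k.+1)).
exact: measurable_behead.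
Qed.

Lemma iint_prod (n : nat) mu (g : nat -> R -> \bar R) :
  (forall k, measurable_fun setT (g k)) -> (forall k x, 0 <= g k x)%E ->
  (iint (raw mu) (fun t : n.-tuple R => \prod_(k < n) g k (tnth t k)) =
   \prod_(k < n) \int[mu k]_x g k x)%E.
Proof.
elim: n mu g => [|n IHn] mu g mg g0 /=; first by rewrite !big_ord0.
rewrite big_ord_recl /=.
have P0 t : (0 <= \prod_(k < n) g k.+1 (tnth t k))%E.
  by apply: prode_ge0 => k.
transitivity (\int[mu 0%N]_x (g 0%N x *
   \prod_(k < n) \int[mu k.+1]_y g k.+1 y))%E.
  apply: eq_integral => x _.
  rewrite -(IHn (fun k => mu k.+1) (fun k => g k.+1))//.
  rewrite -(@iintZl n (fun k => mu k.+1))//; last first.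
    exact: (@measurable_prod_tnth n (fun k => g k.+1)).
  apply: eq_iint => // t; rewrite big_ord_recl; congr (_ * _)%E.
  by apply: eq_bigr => k _; rewrite tnthS.
rewrite ge0_integralZr//.
by apply: prode_ge0 => k _; apply: integral_ge0 => x _.
Qed.

End IteratedIntegral.

(** * Measures with a density *)

Section Density.
Local Open Scope ereal_scope.
Context {d : measure_display} {T : measurableType d} {R : realType}.
Variables (mu : {measure set T -> \bar R}) (D : T -> R).
Hypotheses (mD : measurable_fun setT D) (D0 : forall x, (0 <= D x)%R).

Let mDE (A : set T) : measurable_fun A (EFin \o D).
Proof. exact/measurable_EFinP/measurable_funTS. Qed.

(** [Ftheta] is a bare set function. Equality as functions lets it be replaced by a bundled
    probability, to which the integration lemmas apply. *)
Lemma density_probability : \int[mu]_x (D x)%:E = 1 ->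
  exists nu : probability T R,
    (nu : set T -> \bar R) = (fun A => \int[mu]_(x in A) (D x)%:E).
Proof.
move=> D1; pose nu (A : set T) := \int[mu]_(x in A) (D x)%:E.
have nu0 : nu set0 = 0 by rewrite /nu integral_set0.
have nu_ge0 A : 0 <= nu A by apply: integral_ge0 => x _; rewrite lee_fin.
have nu_sigma : semi_sigma_additive nu.
  move=> /= A mA tA mUA.
  rewrite /nu/= ge0_integral_bigcup//=; last by move=> x _; rewrite lee_fin.
  apply: is_cvg_ereal_nneg_natsum_cond => n _ _.
  by apply: integral_ge0 => /= x _; rewrite lee_fin.
pose numix := isMeasure.Build _ _ _ nu nu0 nu_ge0 nu_sigma.
pose num : {measure set T -> \bar R} := HB.pack nu numix.
have numT : num [set: T] = 1 by [].
pose numixp := @Measure_isProbability.Build _ _ R num numT.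
pose nup : probability T R := HB.pack nu numix numixp.
by exists nup.
Qed.

Import HBNNSimple.

(** For an indicator this is the hypothesis on [nu]; simple functions follow by linearity, and
    monotone convergence along [nnsfun_approx] gives the rest. *)
Lemma ge0_integral_density (nu : {measure set T -> \bar R}) (f : T -> \bar R) :
  (forall A, measurable A -> nu A = \int[mu]_(x in A) (D x)%:E) ->
  measurable_fun setT f -> (forall x, 0 <= f x) ->
  \int[nu]_x f x = \int[mu]_x (f x * (D x)%:E).
Proof.
move=> nuE mf f0.
pose h := nnsfun_approx measurableT mf.
have hf x : EFin \o h ^~ x @ \oo --> f x by exact: cvg_nnsfun_approx.
have -> : \int[nu]_x f x = limn (fun n => \int[nu]_x (h n x)%:E).
  have fE x : f x = limn (EFin \o h ^~ x) by apply/esym/cvg_lim.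
  under eq_integral do rewrite fE.
  apply: monotone_convergence => //.
  - by move=> n; apply/measurable_EFinP.
  - by move=> n x _ //=; rewrite lee_fin.
  - by move=> x _ a b ab; rewrite lee_fin; exact/lefP/nd_nnsfun_approx.
have -> : \int[mu]_x (f x * (D x)%:E) = limn (fun n => \int[mu]_x ((h n x)%:E * (D x)%:E)).
  have fg x : f x * (D x)%:E = limn (fun n => (h n x)%:E * (D x)%:E).
    by apply/esym/cvg_lim => //; apply: cvgeZr => //; exact: hf.
  under eq_integral do rewrite fg.
  apply: monotone_convergence => //.
  - move=> n; apply/emeasurable_funM; first exact/measurable_EFinP.
    exact: mDE.
  - by move=> n x _; rewrite mule_ge0 ?lee_fin.
  - move=> x _ a b ab; apply: lee_wpmul2r; rewrite lee_fin//.
    exact/lefP/nd_nnsfun_approx.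
congr (limn _); apply/funext => n.
have indich r : measurable_fun setT (fun x => (r * \1_(h n @^-1` [set r]) x)%:E).
  by apply: (measurable_comp measurableT) => //; exact: measurable_funM.
transitivity (\int[nu]_x
   (\sum_(y \in range (h n)) (y * \1_(h n @^-1` [set y]) x)%:E)).
  by apply: eq_integral => t tE; rewrite /= fimfunE -fsumEFin.
rewrite ge0_integral_fsum//; last by move=> m y Ey; exact: nnfun_muleindic_ge0.
transitivity (\int[mu]_x (\sum_(y \in range (h n))
    (y * \1_(h n @^-1` [set y]) x)%:E * (D x)%:E)); last first.
  apply: eq_integral => x xE.
  rewrite -ge0_mule_fsuml => [|y]; last exact: nnfun_muleindic_ge0.
  by rewrite fsumEFin // -(fimfunE _ x).
rewrite ge0_integral_fsum//; last 2 first.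
  - by move=> y; apply: emeasurable_funM => //.
  - move=> m y Ey; apply: mule_ge0; last by rewrite lee_fin.
    exact: nnfun_muleindic_ge0.
apply: eq_fsbigr => r rhn.
under eq_integral do rewrite EFinM.
rewrite integralZl_indic_nnsfun//.
under [RHS]eq_integral do rewrite EFinM -muleA.
rewrite ge0_integralZl//.
- congr (_ * _); rewrite integral_indic// setIT nuE//.
  rewrite -[_ @^-1` _]setTI integral_mkcondr epatch_indic setTI.
  by apply: eq_integral => x _; rewrite /= muleC.
- by apply: emeasurable_funM; [exact/measurable_EFinP|exact: mDE].
- by move=> t Et; rewrite mule_ge0 ?lee_fin.
- by move: rhn; rewrite inE => -[t _ <-]; rewrite lee_fin.
Qed.

End Density.

(** * Exponential tilting of [F0] *)

Section Tilting.
Context {R : realType} (F0 : probability R R).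

Definition lr (t x : R) : R := expR (t * x - ln (fine (mgf F0 t))).

Lemma measurable_lr (t : R) : measurable_fun setT (lr t).
Proof.
by apply: measurableT_comp => //; apply: measurable_funB.
Qed.

Lemma lr_ge0 (t x : R) : 0 <= lr t x.
Proof. exact: expR_ge0. Qed.

Lemma measurable_expRM (t : R) (A : set R) :
  measurable_fun A (fun x => (expR (t * x))%:E).
Proof.
by apply/measurable_EFinP/measurable_funTS/measurableT_comp.
Qed.

Lemma mgf_ge0 (t : R) : (0 <= mgf F0 t)%E.
Proof. by apply: integral_ge0 => x _; rewrite lee_fin expR_ge0. Qed.

(** If the integral vanished, the exponential would be zero almost everywhere, although it is
    positive everywhere and [F0] has mass 1. *)
Lemma mgf_gt0 (t : R) : (0 < mgf F0 t)%E.
Proof.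
rewrite lt0e mgf_ge0 andbT; apply/eqP => phi0.
have : ae_eq F0 setT (fun x => (expR (t * x))%:E) (cst 0%E).
  apply/ae_eq_integral_abs => //; first exact: measurable_expRM.
  rewrite -[RHS]phi0; apply: eq_integral => x _.
  by rewrite gee0_abs// lee_fin expR_ge0.
case=> N [mN N0 sub].
have : (F0 setT <= F0 N)%E.
  apply: le_measure; rewrite ?inE// => x _; apply: sub => /= /(_ I) [].
  by apply/eqP; rewrite gt_eqF// expR_gt0.
by rewrite N0 (probability_setT F0) leNgt lte_fin ltr01.
Qed.

Section FiniteMgf.
Variable t : R.
Hypothesis fin : (mgf F0 t < +oo)%E.

Lemma fine_mgfK : ((fine (mgf F0 t))%:E = mgf F0 t)%E.
Proof. by rewrite fineK// ge0_fin_numE// mgf_ge0. Qed.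

Lemma fine_mgf_gt0 : 0 < fine (mgf F0 t).
Proof. by rewrite fine_gt0// mgf_gt0. Qed.

Lemma lrE (x : R) : lr t x = expR (t * x) / fine (mgf F0 t).
Proof. by rewrite /lr expRB lnK// posrE fine_mgf_gt0. Qed.

Lemma integral_lr : (\int[F0]_x (lr t x)%:E = 1)%E.
Proof.
under eq_integral do rewrite lrE EFinM.
have mE := @measurable_expRM t setT.
have E0 x : setT x -> (0 <= (expR (t * x))%:E)%E by rewrite lee_fin expR_ge0.
have Z0 : (0 <= ((fine (mgf F0 t))^-1)%:E)%E.
  by rewrite lee_fin invr_ge0 ltW// fine_mgf_gt0.
rewrite (ge0_integralZr _ measurableT mE E0 Z0).
by rewrite -/(mgf F0 t) -fine_mgfK -EFinM divff// gt_eqF// fine_mgf_gt0.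
Qed.

Lemma Ftheta_probability :
  exists Q : probability R R, (Q : set R -> \bar R) = Ftheta F0 t.
Proof.
exact: (density_probability (measurable_lr t) (lr_ge0 t) integral_lr).
Qed.

Lemma integral_Ftheta (f : R -> \bar R) :
  measurable_fun setT f -> (forall x, 0 <= f x)%E ->
  (\int[Ftheta F0 t]_x f x = \int[F0]_x (f x * (lr t x)%:E))%E.
Proof.
move=> mf f0; have [Q QE] := Ftheta_probability; rewrite -QE.
apply: (ge0_integral_density (measurable_lr t) (lr_ge0 t)) => // A mA.
exact: (congr1 (@^~ A) QE).
Qed.

End FiniteMgf.

End Tilting.

(** * An unpredictable random path *)

Section RandomPath.
Variables (R : realType) (m L : nat).
Hypothesis L_gt0 : (0 < L)%N.

Let N := (2 ^ L).-1.
Let NE : N.+1 = (2 ^ L)%N. Proof. by rewrite /N prednK// expn_gt0. Qed.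

(** Seeds lie in the cyclic group of order [2 ^ L]. For c < L this order is a multiple of [2 ^ c],
    so a uniform seed stays uniform modulo [2 ^ c] and a single type serves all classes. *)
Definition seeds := {ffun 'I_m.+1 -> 'I_N.+1}.
Implicit Types (w : seeds) (k i j c : nat).

(** Write k = (b * 2^c + r) * L + c with c < L and r < 2^c: step k has rank r in block b of class c.
    This is the time with r = 0, whose seed governs the block. *)
Definition block_start k : nat :=
  (k %/ L %/ 2 ^ (k %% L) * 2 ^ (k %% L) * L + k %% L)%N.

(** The rank of step k in its block is compared with the seed modulo the block size. For k <= m the
    index passed to [inord] is at most m, so the conversion is exact. *)
Definition goes_up w k : bool :=
  (k %/ L %% 2 ^ (k %% L) < w (inord (block_start k)) %% 2 ^ (k %% L))%N.

Definition walk w i : int := \sum_(k < i) (if goes_up w k then 1 else -1).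

Lemma walkS w i : walk w i.+1 = walk w i + (if goes_up w i then 1 else -1).
Proof. by rewrite /walk big_ord_recr. Qed.

Lemma is_path_walk n w : is_path n (walk w).
Proof.
split=> [|i _]; first by rewrite /walk big_ord0.
by rewrite walkS addrC addKr; case: goes_up.
Qed.

Lemma eq_walk w w' i : (forall k, (k < i)%N -> goes_up w k = goes_up w' k) ->
  walk w i = walk w' i.
Proof. by move=> ww'; apply: eq_bigr => k _; rewrite ww'. Qed.

Lemma block_start_le k : (block_start k <= k)%N.
Proof.
rewrite /block_start [leqRHS](divn_eq k L) leq_add2r leq_mul2r leq_divM orbT.
by [].
Qed.

Lemma modn_block_start k : (block_start k %% L = k %% L)%N.
Proof. by rewrite /block_start modnMDl modn_mod. Qed.

Lemma block_startE b c r : (c < L)%N -> (r < 2 ^ c)%N ->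
  block_start ((b * 2 ^ c + r) * L + c) = (b * 2 ^ c * L + c)%N.
Proof.
move=> cL rc; rewrite /block_start modnMDl modn_small// divnMDl//.
by rewrite (divn_small cL) addn0 divnMDl ?expn_gt0// (divn_small rc) addn0.
Qed.

(** Translation of one coordinate in the group of seeds. It permutes the seeds, so averaging over
    translates averages over one seed with the others fixed. *)
Definition shift_seed s (v : nat) w : seeds :=
  w + [ffun x => if x == inord s then inZp v else 0].

Lemma shift_seedE s v w x : (shift_seed s v w x : nat) =
  (if x == inord s then (w x + v) %% N.+1 else w x)%N.
Proof.
rewrite /shift_seed !ffunE; case: eqP => _ /=; first by rewrite modnDmr.
by rewrite addn0 modn_small.
Qed.

Lemma goes_up_shift_lt s v w k : (k < s)%N -> (s <= m)%N ->
  goes_up (shift_seed s v w) k = goes_up w k.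
Proof.
move=> ks sm; rewrite /goes_up shift_seedE; case: eqP => // /(congr1 val) /=.
have bk := leq_ltn_trans (block_start_le k) ks.
rewrite !inordK ?ltnS//; first by move=> e; rewrite e ltnn in bk.
by rewrite (leq_trans (ltnW bk)).
Qed.

(* Raising the seed of one block turns down-steps into up-steps, so the walk
   after that block is an increasing function of the seed modulo the block
   size. *)
Lemma walk_shift_inj c b w i : (c < L)%N ->
  (b.+1 * 2 ^ c * L <= i)%N -> (i <= m.+1)%N ->
  injective (fun v : 'I_(2 ^ c) => walk (shift_seed (b * 2 ^ c * L + c) v w) i).
Proof.
move=> cL bi im; set s := (b * 2 ^ c * L + c)%N.
have cN : (2 ^ c %| N.+1)%N by rewrite NE dvdn_exp2l// ltnW.
have blk r : (r < 2 ^ c)%N -> ((b * 2 ^ c + r) * L + c < i)%N.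
  move=> rc; apply: leq_trans bi; rewrite mulSn -addnS.
  apply: (@leq_trans ((b * 2 ^ c + r) * L + L)); first by rewrite leq_add2l.
  by rewrite -mulSnr leq_mul2r -addnS addnC leq_add2r rc orbT.
have si : (s < i)%N by have := blk 0%N; rewrite addn0 expn_gt0; apply.
have sm : (s <= m)%N by rewrite -ltnS (leq_trans si).
pose a (v : nat) := ((w (inord s) + v) %% 2 ^ c)%N.
have upE v k : (k < i)%N -> block_start k = s ->
    goes_up (shift_seed s v w) k = (k %/ L %% 2 ^ c < a v)%N.
  move=> ki ks; have kc : (k %% L = c)%N.
    by rewrite -modn_block_start ks /s modnMDl modn_small.
  by rewrite /goes_up shift_seedE ks eqxx kc modn_dvdm.
have upN v k : (k < i)%N -> block_start k != s ->
    goes_up (shift_seed s v w) k = goes_up w k.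
  move=> ki ks; rewrite /goes_up shift_seedE; case: eqP => // /(congr1 val) /=.
  rewrite !inordK ?ltnS//; first by move=> e; rewrite e eqxx in ks.
  by rewrite (leq_trans (block_start_le k))// -ltnS (leq_trans ki).
have mono v v' : (a v < a v')%N ->
    walk (shift_seed s v w) i < walk (shift_seed s v' w) i.
  move=> vv'; have avc : (a v < 2 ^ c)%N by rewrite ltn_pmod// expn_gt0.
  (* The step [k0] of rank [a v] goes down under [v] and up under [v'], while no other step is lower
     under [v']; so the sum strictly increases. *)
  have k0i := blk _ avc; set k0 := (_ * L + c)%N in k0i.
  have k0s : block_start k0 = s by exact: block_startE.
  have k0E : (k0 %/ L %% 2 ^ c = a v)%N.
    by rewrite /k0 divnMDl// (divn_small cL) addn0 modnMDl modn_small.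
  rewrite /walk (bigD1 (Ordinal k0i))//= [ltRHS](bigD1 (Ordinal k0i))//=.
  apply: ltr_leD.
    by rewrite !upE// k0E ltnn vv'.
  apply: ler_sum => k _; have [ks|ks] := eqVneq (block_start k) s; last first.
    by rewrite !upN.
  rewrite !upE//; case: ifP => [h|_]; last by case: ifP.
  by rewrite (ltn_trans h vv').
move=> v v' /= vv'; apply/val_inj/eqP => /=.
have : a v = a v'.
  by case: (ltngtP (a v) (a v')) => // /mono; rewrite vv' ltxx.
by move=> /eqP; rewrite /a eqn_modDl !modn_small.
Qed.

Definition mean (f : seeds -> R) : R := (#|{: seeds}|%:R)^-1 * \sum_w f w.

Lemma card_seeds_gt0 : 0 < #|{: seeds}|%:R :> R.
Proof. by rewrite ltr0n; apply/card_gt0P; exists [ffun=> ord0]. Qed.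

Lemma mean_cst (a : R) : mean (fun=> a) = a.
Proof.
by rewrite /mean sumr_const -[a *+ _]mulr_natl mulKf// gt_eqF// card_seeds_gt0.
Qed.

Lemma meanD f g : mean (fun w => f w + g w) = mean f + mean g.
Proof. by rewrite /mean big_split mulrDr. Qed.

Lemma meanZl (a : R) f : mean (fun w => a * f w) = a * mean f.
Proof. by rewrite /mean -mulr_sumr mulrCA. Qed.

Lemma mean_sum n (f : 'I_n -> seeds -> R) :
  mean (fun w => \sum_(i < n) f i w) = \sum_(i < n) mean (f i).
Proof. by rewrite /mean exchange_big mulr_sumr. Qed.

Lemma le_mean f g : (forall w, f w <= g w) -> mean f <= mean g.
Proof.
move=> fg; apply: ler_wpM2l; first by rewrite invr_ge0 ltW// card_seeds_gt0.
exact: ler_sum.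
Qed.

Lemma mean_ge0 f : (forall w, 0 <= f w) -> 0 <= mean f.
Proof. by move=> f0; rewrite -(mean_cst 0); exact: le_mean. Qed.

Lemma mean_shift s v f : mean (fun w => f (shift_seed s v w)) = mean f.
Proof.
rewrite /mean; congr (_ * _); rewrite /shift_seed.
by rewrite [RHS](reindex_inj (addIr [ffun x => if x == inord s then inZp v else 0])).
Qed.

(** An interval of length [2 ^ c.+1 * L] contains a whole block of class c. Among [2 ^ c] translates
    of its seed at most one puts the walk at [x], by injectivity, and none changes [G], which
    depends on earlier steps only. The weight [G] plays the part of conditioning on the past. *)
Lemma walk_unpredictable_pow2 c j i (x : int) (G : seeds -> R) :
  (c < L)%N -> (j + 2 ^ c.+1 * L <= i)%N -> (i <= m.+1)%N ->
  (forall w, 0 <= G w) ->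
  (forall w w', (forall k, (k < j)%N -> goes_up w k = goes_up w' k) -> G w = G w') ->
  (2 ^ c)%:R * mean (fun w => (walk w i == x)%:R * G w) <= mean G.
Proof.
move=> cL ji im G0 Gj.
(* Block [b] is the first to begin strictly after the multiple of [2 ^ c * L] just below or at j; it
   ends by j + 2 * 2^c * L <= i. *)
pose b := (j %/ (2 ^ c * L)).+1; pose s := (b * 2 ^ c * L + c)%N.
have P0 : (0 < 2 ^ c * L)%N by rewrite muln_gt0 expn_gt0.
have bi : (b.+1 * 2 ^ c * L <= i)%N.
  apply: leq_trans ji; rewrite expnS -!mulnA /b !mulSn.
  by have := leq_divM j (2 ^ c * L); lia.
have js : (j <= s)%N.
  rewrite /s -mulnA /b (leq_trans (ltnW (ltn_ceil j P0)))//.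
  exact: leq_addr.
have si : (s < i)%N.
  apply: leq_trans bi; rewrite /s mulSn mulnDl addnC ltn_add2r.
  by rewrite (leq_trans cL)// leq_pmull// expn_gt0.
have sm : (s <= m)%N by rewrite -ltnS (leq_trans si).
rewrite -[X in X%:R * _]card_ord mulr_natl -sumr_const.
under eq_bigr => v _ do rewrite -(mean_shift s v).
rewrite -mean_sum.
apply: le_mean => w.
have GE (v : 'I_(2 ^ c)) : G (shift_seed s v w) = G w.
  by apply: Gj => k kj; apply: goes_up_shift_lt => //; exact: leq_trans js.
under eq_bigr do rewrite GE.
rewrite -mulr_suml -[leRHS]mul1r; apply: ler_wpM2r => //.
have inj := walk_shift_inj (w := w) cL bi im; rewrite -/s in inj.
rewrite -natr_sum (_ : 1 = 1%:R)// ler_nat.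
rewrite -big_mkcond /= sum1dep_card.
apply/card_le1P => v; rewrite inE => /eqP vx v'; rewrite !inE.
by rewrite -vx; apply/eqP/eqP => [/inj|->].
Qed.

(** Bound on the chance of being at a given point k steps later. At k = 0 the quotient would be 0 by
    convention, so the trivial bound 1 is used. *)
Definition predictability k : R := if k is 0%N then 1 else 4 * L%:R / k%:R.

Lemma predictability_ge0 k : 0 <= predictability k.
Proof. by case: k => //= k; rewrite divr_ge0// mulr_ge0. Qed.

Hypothesis mL : (m.+1 <= 2 ^ L)%N.

Lemma walk_unpredictable j i (x : int) (G : seeds -> R) :
  (j <= i)%N -> (i <= m.+1)%N -> (forall w, 0 <= G w) ->
  (forall w w', (forall k, (k < j)%N -> goes_up w k = goes_up w' k) -> G w = G w') ->
  mean (fun w => (walk w i == x)%:R * G w) <= predictability (i - j) * mean G.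
Proof.
move=> ji im G0 Gj.
have triv (a : R) : 1 <= a -> mean (fun w => (walk w i == x)%:R * G w) <= a * mean G.
  move=> a1; apply: (@le_trans _ _ (mean G)).
    by apply: le_mean => w; case: eqP => _; rewrite ?mul1r// mul0r.
  by rewrite -[leLHS]mul1r ler_wpM2r// mean_ge0.
case: (posnP (i - j)) => [->|k0]; first exact: triv.
have -> : predictability (i - j) = 4 * L%:R / (i - j)%:R by case: (i - j)%N k0.
set k := (i - j)%N in k0 *.
have k0R : 0 < k%:R :> R by rewrite ltr0n.
(* Below 2 L the bound 4 L / k is at least 1, hence trivial. *)
have [kL|kL] := ltnP k (2 * L).
  apply: triv; rewrite ler_pdivlMr// mul1r -natrM ler_nat.
  by rewrite (leq_trans (ltnW kL))// leq_mul2r orbT.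
(* Then [2 ^ c1 * L <= k < 2 ^ c1.+1 * L], so class [c1.-1] has a whole block between j and i, and
   [2 ^ c1.-1] exceeds k / (4 L). *)
pose c1 := trunc_log 2 (k %/ L).
have kL2 : (2 <= k %/ L)%N by rewrite leq_divRL.
have c1_gt0 : (0 < c1)%N by rewrite trunc_log_gt0.
have /andP[c1l c1u] := trunc_log_bounds (isT : (1 < 2)%N) (ltnW kL2).
rewrite -/c1 in c1l c1u.
(* The class exists because [2 ^ c1 <= k <= m.+1 <= 2 ^ L]. *)
have cL : (c1.-1 < L)%N.
  rewrite prednK// -(leq_exp2l (m := 2))// (leq_trans c1l)//.
  by rewrite (leq_trans (leq_div _ _))// (leq_trans _ mL)// (leq_trans (leq_subr _ _)).
have := @walk_unpredictable_pow2 c1.-1 j i x G cL.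
rewrite prednK// => /(_ _ im G0 Gj) H.
have {}H := H _.
set E := mean _ in H *.
have p0 : 0 < (2 ^ c1.-1)%:R :> R by rewrite ltr0n expn_gt0.
have : (2 ^ c1.-1)%:R * E <= mean G.
  apply: H; rewrite -(subnKC ji) leq_add2l -/k.
  by rewrite (leq_trans _ (leq_divM k L))// leq_mul2r c1l orbT.
rewrite mulrC -ler_pdivlMr// => /le_trans; apply.
rewrite mulrC; apply: ler_wpM2r; first exact: mean_ge0.
rewrite ler_pdivlMr// mulrC ler_pdivrMr// -!natrM ler_nat.
have -> : (4 * L * 2 ^ c1.-1 = 2 ^ c1.+1 * L)%N.
  by rewrite -{2}(prednK c1_gt0) !expnS; lia.
by rewrite ltnW// -ltn_divLR.
Qed.

End RandomPath.

(** * Harmonic sums against the logarithm *)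

Section Harmonic.
Context {R : realType}.

Lemma ln_le_harmonic n : ln n.+1%:R <= \sum_(k < n) (k.+1%:R)^-1 :> R.
Proof.
elim: n => [|n IHn]; first by rewrite big_ord0 ln1.
rewrite big_ord_recr /= -lerBlDr; apply: le_trans IHn.
have n0 : 0 < n.+1%:R :> R by rewrite ltr0n.
have -> : n.+2%:R = n.+1%:R * (1 + n.+1%:R^-1) :> R.
  by rewrite mulrDr mulr1 divff ?gt_eqF// -natr1.
rewrite lnM ?posrE//.
by rewrite -addrA gerDl subr_le0 le_ln1Dx// (lt_trans (ltrN10 _))// invr_gt0.
Qed.

Lemma harmonic_le_ln n : \sum_(k < n.+1) (k.+1%:R)^-1 <= 1 + ln n.+1%:R :> R.
Proof.
elim: n => [|n IHn]; first by rewrite big_ord1 ln1 addr0 invr1.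
rewrite big_ord_recr /= -lerBrDr; apply: (le_trans IHn).
have n0 : 0 < n.+1%:R :> R by rewrite ltr0n.
have n1 : 0 < n.+2%:R :> R by rewrite ltr0n.
have -> : n.+1%:R = n.+2%:R * (1 - n.+2%:R^-1) :> R.
  by rewrite mulrBr mulr1 divff ?gt_eqF// -[n.+2%:R]natr1 addrK.
have n2 : n.+2%:R^-1 < 1 :> R by rewrite invf_lt1// ltr1n.
rewrite lnM ?posrE ?subr_gt0// addrA lerD2l.
by rewrite le_ln1Dx// ltrN2.
Qed.

End Harmonic.

(** * Exponential moments of the number of meetings with a fixed path *)

Section Intersections.
Variables (R : realType) (m L : nat) (q : nat -> int) (l : R).
Hypotheses (L_gt0 : (0 < L)%N) (mL : (m.+1 <= 2 ^ L)%N) (l_ge0 : 0 <= l).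

Definition meets (p q : nat -> int) (n : nat) : nat := \sum_(i < n) (p i == q i).

Local Notation seeds := (seeds m L).
Local Notation mean := (@mean R m L).
Local Notation pred_ k := (predictability R L k).

(** Expected weight carried by a meeting at time i. The path [q] is arbitrary and fixed: the
    randomness of one of the two walks suffices. *)
Let a i : R :=
  mean (fun w => (walk w i == q i)%:R * (1 + l) ^+ meets (walk w) q i).

Let l1_ge0 : 0 <= 1 + l. Proof. by rewrite addr_ge0. Qed.

Let a_ge0 i : 0 <= a i.
Proof. by apply: mean_ge0 => w; rewrite mulr_ge0// exprn_ge0. Qed.

(** A meeting at time i multiplies the power by 1 + l, hence adds l times its current value; other
    times leave it unchanged. *)
Lemma meets_telescope (p : nat -> int) n : (1 + l) ^+ meets p q n =
  1 + l * \sum_(i < n) (p i == q i)%:R * (1 + l) ^+ meets p q i.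
Proof.
elim: n => [|n IHn]; first by rewrite /meets !big_ord0 mulr0 addr0.
rewrite big_ord_recr /= mulrDr addrA -IHn {1}/meets big_ord_recr /= -/(meets p q n).
rewrite exprD; case: eqP => _ /=; first by rewrite expr1 mul1r; ring.
by rewrite expr0 mul0r mulr0 mulr1 addr0.
Qed.

Lemma mean_meets n :
  mean (fun w => (1 + l) ^+ meets (walk w) q n) = 1 + l * \sum_(i < n) a i.
Proof.
rewrite -mean_sum -meanZl -[X in _ = X + _](@mean_cst R m L) -meanD.
by congr mean; apply/funext => w; rewrite meets_telescope.
Qed.

Lemma meets_eq (w w' : seeds) i :
  (forall k, (k < i)%N -> goes_up w k = goes_up w' k) ->
  meets (walk w) q i = meets (walk w') q i.
Proof.
move=> ww'; apply: eq_bigr => k _; rewrite (@eq_walk _ _ w w')// => j jk.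
by apply: ww'; exact: ltn_trans (ltn_ord k).
Qed.

(** Expand the power over the meetings at times j < i. The weight at j depends only on the steps
    before j, so unpredictability from j to i applies; the constant term uses it from time 0. *)
Let a_rec i : (i <= m.+1)%N ->
  a i <= pred_ i + l * \sum_(j < i) pred_ (i - j) * a j.
Proof.
move=> im; rewrite /a.
have -> : mean (fun w => (walk w i == q i)%:R * (1 + l) ^+ meets (walk w) q i) =
  mean (fun w => (walk w i == q i)%:R * 1) + l * \sum_(j < i)
   mean (fun w => (walk w i == q i)%:R *
     ((walk w j == q j)%:R * (1 + l) ^+ meets (walk w) q j)).
  rewrite -mean_sum -meanZl -meanD; congr mean; apply/funext => w.
  by rewrite meets_telescope mulrDr mulrCA mulr_sumr.
apply: lerD.
  have := @walk_unpredictable R m L L_gt0 mL 0 i (q i) (fun=> 1) isT im.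
  by rewrite subn0 mean_cst mulr1; apply.
apply: ler_wpM2l => //; apply: ler_sum => j _.
apply: walk_unpredictable => //; first exact: ltnW.
  by move=> w; rewrite mulr_ge0// exprn_ge0.
by move=> w w' ww'; rewrite (meets_eq ww') (eq_walk ww').
Qed.

Let predictability_tail n j :
  \sum_(i < n | (j < i)%N) pred_ (i - j) <= \sum_(k < n) pred_ k.
Proof.
rewrite -(big_geq_mkord j.+1 n predT (fun i => pred_ (i - j))).
rewrite -{1}[j.+1]add0n big_addn.
under eq_bigr do rewrite -addSnnS addnK.
have [nj|nj] := leqP n j.+1.
  rewrite (eqP nj) big_geq//; apply: sumr_ge0 => k _; exact: predictability_ge0.
rewrite -(big_mkord predT (fun k => pred_ k)).
rewrite -(big_add1 _ _ _ (n - j.+1).+1 predT (fun k => pred_ k)).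
rewrite [leRHS](@big_cat_nat _ _ _ 1)//=; last by rewrite (leq_trans _ nj).
rewrite [X in _ <= _ + X](@big_cat_nat _ _ _ (n - j.+1).+1)//=; last first.
  by lia.
rewrite addrCA lerDl addr_ge0//; apply: sumr_ge0 => k _; exact: predictability_ge0.
Qed.

(** Summing the recursion and exchanging the two sums gives a renewal inequality: each j contributes
    [a j] times a sum of [pred_ (i - j)], bounded by the full sum. *)
Let sum_a n : (n <= m.+2)%N ->
  \sum_(i < n) a i <=
  \sum_(k < n) pred_ k + l * (\sum_(k < n) pred_ k) * \sum_(i < n) a i.
Proof.
move=> nm; apply: (@le_trans _ _ (\sum_(i < n) (pred_ i + l * \sum_(j < i) pred_ (i - j) * a j))).
  by apply: ler_sum => i _; apply: a_rec; rewrite -ltnS (leq_trans (ltn_ord i)).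
rewrite big_split lerD2l -mulr_sumr -mulrA; apply: ler_wpM2l => //.
under eq_bigr => i _ do
  rewrite (big_ord_widen n (fun j => pred_ (i - j) * a j) (ltnW (ltn_ord i))).
rewrite (exchange_big_dep predT)//= mulr_sumr; apply: ler_sum => j _.
rewrite -mulr_suml; apply: ler_wpM2r; first exact: a_ge0.
exact: predictability_tail.
Qed.

(** With S the finite sum of the [a i], the inequality S <= A + l A S can be solved because l A < 1,
    and the mean equals 1 + l S. *)
Lemma mean_meets_le n (A : R) : (n <= m.+2)%N ->
  \sum_(k < n) pred_ k <= A -> l * A < 1 ->
  mean (fun w => (1 + l) ^+ meets (walk w) q n) <= (1 - l * A)^-1.
Proof.
move=> nm pA lA; rewrite mean_meets; set S := \sum_(i < n) a i.
have S0 : 0 <= S by exact: sumr_ge0.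
have SA : S <= A + l * A * S.
  apply: (le_trans (sum_a nm)); apply: lerD => //.
  by rewrite ler_wpM2r// ler_wpM2l.
have lA0 : 0 < 1 - l * A by rewrite subr_gt0.
rewrite -[leRHS]mul1r ler_pdivlMr//.
have : l * S <= l * (A + l * A * S) by exact: ler_wpM2l.
nra.
Qed.

End Intersections.

Lemma sum_predictability_le (R : realType) (L n : nat) :
  \sum_(k < n.+1) predictability R L k <= 1 + 4 * L%:R * (1 + ln n.+1%:R).
Proof.
rewrite big_ord_recl lerD2l.
under eq_bigr do rewrite /=.
rewrite -mulr_sumr ler_wpM2l ?mulr_ge0//.
apply: le_trans (harmonic_le_ln n); rewrite big_ord_recr /= lerDl.
by rewrite invr_ge0.
Qed.

(** * The lattice *)

Section Lattice.
Implicit Types (m : nat) (p : nat -> int).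

(** The column is shifted by m to become a natural number, so level i is the set of j < 2 m that
    pass [in_V]. *)
Lemma sum_vert (V : nmodType) m (G : nat * int -> V) :
  \sum_(k < nV m) G (vert m k) =
  \sum_(i < m) \sum_(j < 2 * m | in_V m (i : nat, j%:Z - m%:Z)) G (i : nat, j%:Z - m%:Z).
Proof.
rewrite -(big_mkord predT (fun k => G (vert m k))) /nV /vert -(big_nth (0%N, 0) predT).
rewrite /Vlist big_filter big_mkcond big_allpairs_dep /=.
rewrite -(big_mkord predT (fun i =>
  \sum_(j < 2 * m | in_V m (i, j%:Z - m%:Z)) G (i, j%:Z - m%:Z))) /index_iota subn0.
apply: eq_bigr => i _; rewrite [RHS]big_mkcond /=.
by rewrite -(big_mkord predT (fun j => if in_V m (i, j%:Z - m%:Z)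
  then G (i, j%:Z - m%:Z) else 0)) /index_iota subn0.
Qed.

Lemma path_in_V m p i : is_path m p -> (i < m)%N -> in_V m (i, p i).
Proof.
move=> [p0 pS] im; rewrite /in_V /= im /=.
elim: i im => [|i IHi] im; first by rewrite p0.
have {IHi} /and3P[lo hi /eqP par] := IHi (ltnW im).
have := pS i im.
set x := p i.+1 in lo hi par *; set y := p i in lo hi par *.
move=> xy; apply/and3P; split; lia.
Qed.

(** On level i the only surviving shifted column is [p i] + m, which is in range because a path
    stays in the lattice. *)
Lemma sum_on_path (V : nmodType) m p (F : nat * int -> V) : is_path m p ->
  \sum_(k < nV m | on_path p (vert m k)) F (vert m k) = \sum_(i < m) F (i : nat, p i).
Proof.
move=> pm; rewrite big_mkcond.
rewrite (sum_vert m (fun v => if on_path p v then F v else 0)).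
apply: eq_bigr => i _; have pV := path_in_V pm (ltn_ord i).
have [/= _ lo hi par] := and4P pV.
have im := ltn_ord i.
have jm : (absz (p i + m%:Z)%R < 2 * m)%N by lia.
have jE : (absz (p i + m%:Z)%R)%:Z - m%:Z = p i by lia.
rewrite (bigD1 (Ordinal jm)) ?jE//= /on_path /= ?jE eqxx.
rewrite big1 ?addr0// => j /andP[_ /eqP jne].
case: eqP => // jp; exfalso; apply: jne; apply: val_inj => /=; lia.
Qed.

Lemma sum_interval_le n a b : (\sum_(j < n | a <= j < b) 1 <= b - a)%N.
Proof.
suff : (\sum_(j < n | a <= j < b) 1 <= minn n b - a)%N by lia.
rewrite big_mkcond /=; elim: n => [|n]; first by rewrite big_ord0.
by rewrite big_ord_recr /=; case: ifP; lia.
Qed.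

Lemma sum_level_le (R : realType) m (c : nat -> R) : (forall i, 0 <= c i) ->
  \sum_(k < nV m) c (vert m k).1 <= \sum_(i < m) c i * (2 * i).+1%:R.
Proof.
move=> c0; rewrite (sum_vert m (fun v => c v.1)).
apply: ler_sum => i _ /=; rewrite sumr_const -[leLHS]mulr_natr.
apply: ler_wpM2l => //; rewrite ler_nat -sum1_card.
(* Ignoring parity, level i occupies the shifted columns from m - i to m + i. *)
apply: leq_trans (leq_trans (sum_interval_le (2 * m) (m - i) (m + i).+1) _); last by lia.
rewrite [leqRHS]big_mkcond [leqLHS]big_mkcond /=; apply: leq_sum => j _.
case: ifP => // /and4P[_ /= lo hi _].
by case: ifP => //; lia.
Qed.

End Lattice.

(** * Detection *)

Section TwoValued.
Context {R : realType}.

Lemma integral_two_valued (mu : probability R R) (A : set R) (q : R) (phi : R -> R) :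
  measurable A -> mu A = q%:E -> (forall y, 0 <= phi y) ->
  (\int[mu]_x (phi (\1_A x))%:E = (phi 1 * q + phi 0 * (1 - q))%:E)%E.
Proof.
move=> mA muA phi0.
have muC : mu (~` A) = (1 - q)%:E by rewrite probability_setC// muA.
transitivity (\int[mu]_x ((phi 1)%:E * (\1_A x)%:E + (phi 0)%:E * (\1_(~` A) x)%:E))%E.
  apply: eq_integral => x _; rewrite -!EFinM -EFinD !indicE in_setC.
  by case: (x \in A); rewrite /= ?mulr1 ?mulr0 ?addr0 ?add0r.
have mI (B : set R) : measurable B -> measurable_fun setT (fun x => (\1_B x)%:E : \bar R).
  by move=> mB; apply/measurable_EFinP; exact: measurable_indic.
have I0 (B : set R) x : (0 <= (\1_B x)%:E :> \bar R)%E by rewrite lee_fin indicE.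
have mAc : measurable (~` A) by exact: measurableC.
rewrite ge0_integralD//; last 4 first.
- by move=> x _; rewrite mule_ge0 ?lee_fin.
- by apply: emeasurable_funM; [exact: measurable_cst|exact: mI].
- by move=> x _; rewrite mule_ge0 ?lee_fin.
- by apply: emeasurable_funM; [exact: measurable_cst|exact: mI].
rewrite !ge0_integralZl ?lee_fin//; try by exact: mI.
transitivity ((phi 1)%:E * mu A + (phi 0)%:E * mu (~` A))%E.
  by congr (_ * _ + _ * _)%E; rewrite integral_indic// setIT.
by rewrite muA muC -!EFinM -EFinD.
Qed.

(** Integrating out the later coordinates leaves the same form with the first term moved into the
    offset [a]; its cross term then vanishes because the first indicator has mean [q 0]. *)
Lemma iint_second_moment (A : set R) (n : nat) (mu : nat -> probability R R)
    (q w : nat -> R) (a : R) : measurable A -> (forall k, mu k A = (q k)%:E) ->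
  (iint (fun k => mu k : set R -> \bar R) (fun t : n.-tuple R =>
     ((a + \sum_(k < n) w k * (\1_A (tnth t k) - q k)) ^+ 2)%:E) =
   (a ^+ 2 + \sum_(k < n) (w k) ^+ 2 * (q k * (1 - q k)))%:E)%E.
Proof.
move=> mA; elim: n mu q w a => [|n IHn] mu q w a muq /=.
  by rewrite !big_ord0 !addr0.
set V := \sum_(k < n) (w k.+1) ^+ 2 * (q k.+1 * (1 - q k.+1)).
have q01 k : 0 <= q k * (1 - q k).
  have q0 : 0 <= q k by rewrite -lee_fin -muq.
  by rewrite mulr_ge0// subr_ge0 -lee_fin -muq probability_le1.
pose phi y := (a + w 0%N * (y - q 0%N)) ^+ 2 + V.
transitivity (\int[mu 0%N]_x (phi (\1_A x))%:E)%E.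
  apply: eq_integral => x _ /=.
  rewrite -(IHn (fun k => mu k.+1) (fun k => q k.+1) (fun k => w k.+1))//.
  apply: eq_iint => // t; rewrite big_ord_recl addrA /=.
  congr (_%:E); congr (_ ^+ 2); congr (_ + _); apply: eq_bigr => k _.
  by rewrite tnthS.
rewrite (@integral_two_valued (mu 0%N) A (q 0%N) phi mA (muq _)); last first.
  move=> y; rewrite addr_ge0 ?sqr_ge0//; apply: sumr_ge0 => k _.
  by rewrite mulr_ge0 ?sqr_ge0.
rewrite /phi; by congr (_%:E); rewrite big_ord_recl /= -/V; ring.
Qed.

Lemma measurable_weighted_count (A : set R) (n : nat) (w q : nat -> R) :
  measurable A -> measurable_fun setT
    (fun t : n.-tuple R => \sum_(k < n) w k * (\1_A (tnth t k) - q k)).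
Proof.
move=> mA; apply: measurable_sum => k.
apply: measurable_funM => //; apply: measurable_funB => //.
apply: measurableT_comp; first exact: measurable_indic.
exact: measurable_tnth.
Qed.

Lemma measurable_ind (d : measure_display) (U : measurableType d) (T : U -> bool) :
  measurable_fun setT T -> measurable_fun setT (fun t => ind R (T t)).
Proof. by move=> mT; apply: (@measurableT_comp _ _ _ _ _ _ (ind R)). Qed.

Lemma iint_chebyshev (A : set R) (n : nat) (mu : nat -> probability R R)
    (q w : nat -> R) (h W : R) (T : n.-tuple R -> bool) :
  measurable A -> (forall k, mu k A = (q k)%:E) -> 0 < h ->
  \sum_(k < n) (w k) ^+ 2 <= W -> measurable_fun setT T ->
  (forall t, T t -> h <= `|\sum_(k < n) w k * (\1_A (tnth t k) - q k)|) ->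
  (iint (fun k => mu k : set R -> \bar R) (fun t => ind R (T t)) <= (W / h ^+ 2)%:E)%E.
Proof.
move=> mA muq h0 wW mT Th.
pose S (t : n.-tuple R) := \sum_(k < n) w k * (\1_A (tnth t k) - q k).
have mS : measurable_fun setT S by exact: measurable_weighted_count.
have h2 : 0 < h ^+ 2 by rewrite exprn_gt0.
have mind := measurable_ind mT.
apply: (@le_trans _ _ (iint (fun k => mu k : set R -> \bar R)
    (fun t => (h ^- 2)%:E * ((0 + S t) ^+ 2)%:E)%E)).
  apply: le_iint => //.
  - by move=> t; rewrite lee_fin.
  - apply/measurable_EFinP/measurable_funM => //; apply: measurable_funX.
    exact: measurable_funD.
  move=> t; rewrite add0r /ind -EFinM lee_fin; case: (boolP (T t)) => /= [/Th hS|_].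
    rewrite mulrC ler_pdivlMr// mul1r -[leRHS]real_normK ?num_real//.
    by rewrite lerXn2r// ?nnegrE// ltW.
  by rewrite mulr_ge0 ?sqr_ge0// invr_ge0 ltW.
rewrite iintZl//; last 3 first.
- by rewrite lee_fin invr_ge0 ltW.
- apply/measurable_EFinP; apply: measurable_funX; exact: measurable_funD.
- by move=> t; rewrite lee_fin sqr_ge0.
rewrite [X in (_ * X)%E](iint_second_moment n w 0 mA muq) -EFinM lee_fin mulrC.
apply: ler_wpM2r; first by rewrite invr_ge0 ltW.
rewrite expr0n /= add0r; apply: le_trans wW; apply: ler_sum => k _.
have q0 : 0 <= q k by rewrite -lee_fin -muq.
have q1 : q k <= 1 by rewrite -lee_fin -muq probability_le1.
rewrite -[leRHS]mulr1 ler_wpM2l ?sqr_ge0//; nra.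
Qed.

End TwoValued.

(** * Separating thresholds for a nondegenerate law *)

Section Separation.
Context {R : realType} (F0 : probability R R).

Lemma measure_bigcup_eq0 (A : nat -> set R) : (forall n, measurable (A n)) ->
  (forall n, F0 (A n) = 0%E) -> F0 (\bigcup_n A n) = 0%E.
Proof.
move=> mA A0; have : F0.-negligible (\bigcup_n A n).
  by apply: negligible_bigcup => n; exists (A n); split => //; exact: A0.
by move/negligibleP; apply; exact: bigcupT_measurable.
Qed.

(** The open ray is a countable union of closed rays from c + 1 / (n + 1), which cannot all be null.
    Beyond the gap d, tilting gains a definite factor. *)
Lemma measure_ray_open (c : R) : (0 < F0 [set x | c < x]%R)%E ->
  exists2 d, 0 < d & (0 < F0 [set x | c + d <= x]%R)%E.
Proof.
move=> Fc; apply: contrapT => nex.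
suff : F0 [set x | c < x] = 0%E by move=> F00; rewrite F00 ltxx in Fc.
have -> : [set x | c < x] = \bigcup_n [set x | c + n.+1%:R^-1 <= x].
  apply/seteqP; split => [x /= cx|x [n _] /=].
    by have [n cn] := ltr_add_invr cx; exists n => //=; exact: ltW.
  by apply: lt_le_trans; rewrite ltrDl.
apply: measure_bigcup_eq0 => n.
  by rewrite -set_itvcy; exact: measurable_itv.
apply/eqP/negP => /negP Fn; apply: nex; exists n.+1%:R^-1; first by rewrite invr_gt0.
by rewrite lt0e Fn measure_ge0.
Qed.

(** If every c had a null ray on one side, the infimum of the points with null right ray would carry
    all the mass. *)
Lemma nondegenerate_split : ~ (exists c, F0 [set c] = 1%E) ->
  exists c, (0 < F0 [set x | x <= c]%R)%E /\ (0 < F0 [set x | c < x]%R)%E.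
Proof.
move=> nondeg; apply: contrapT => nex.
have mle c : measurable [set x : R | x <= c] by rewrite -set_itvNyc; exact: measurable_itv.
have mgt c : measurable [set x : R | c < x] by rewrite -set_itvoy; exact: measurable_itv.
have dich c : F0 [set x | x <= c] = 0%E \/ F0 [set x | c < x] = 0%E.
  apply: contrapT => /not_orP[/eqP n1 /eqP n2]; apply: nex; exists c.
  by rewrite !lt0e n1 n2 !measure_ge0.
have FT0 : F0 setT <> 0%E.
  by rewrite probability_setT => /eqP; rewrite onee_eq0.
have CE c : ~` [set x : R | x <= c] = [set x | c < x].
  by apply/seteqP; split => x /=; rewrite ltNge; move/negP.
have both c : F0 [set x | x <= c] = 0%E -> F0 [set x | c < x] <> 0%E.
  by move=> F1; rewrite -CE probability_setC// F1 sube0 => /eqP; rewrite onee_eq0.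
pose S : set R := [set x | F0 [set y | x < y] = 0%E].
have [u Su] : S !=set0.
  apply: contrapT => S0; apply: FT0.
  have -> : [set: R] = \bigcup_n [set x | x <= n%:R].
    apply/seteqP; split => // x _; exists (Num.bound `|x|) => //=.
    by rewrite (le_trans (ler_norm x))// ltW// archi_boundP// normr_ge0.
  apply: measure_bigcup_eq0 => // n; have [//|Sn] := dich n%:R.
  by exfalso; apply: S0; exists n%:R.
have [v Sv] : exists v, ~ S v.
  apply: contrapT => S0; apply: FT0.
  have -> : [set: R] = \bigcup_n [set x | - n%:R < x].
    apply/seteqP; split => // x _; exists (Num.bound `|x|) => //=.
    rewrite ltrNl (le_lt_trans _ (archi_boundP (normr_ge0 x)))//.
    by rewrite -normrN ler_norm.
  apply: measure_bigcup_eq0 => // n; apply: contrapT => Sn.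
  by apply: S0; exists (- n%:R).
have lbS : has_lbound S.
  exists v => x Sx; rewrite leNgt; apply/negP => xv; apply: Sv.
  apply/eqP; rewrite eq_le measure_ge0 andbT -Sx.
  by apply: le_measure; rewrite ?inE// => y /=; exact: lt_trans.
have hiS : has_inf S by split => //; exists u.
apply: nondeg; exists (inf S).
have lo : F0 [set x | x < inf S] = 0%E.
  have -> : [set x | x < inf S] = \bigcup_n [set x | x <= inf S - n.+1%:R^-1].
    apply/seteqP; split => [x /= xS|x [n _] /=].
      have [n cn] := ltr_add_invr xS; exists n => //=.
      by rewrite lerBrDr ltW.
    by move=> /le_lt_trans; apply; rewrite gtrBl.
  apply: measure_bigcup_eq0 => // n; have [//|Sn] := dich (inf S - n.+1%:R^-1).
  have : inf S <= inf S - n.+1%:R^-1 by exact: ge_inf.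
  by rewrite lerBrDr gerDl leNgt invr_gt0 ltr0n.
have hi : F0 [set x | inf S < x] = 0%E.
  have -> : [set x | inf S < x] = \bigcup_n [set x | inf S + n.+1%:R^-1 < x].
    apply/seteqP; split => [x /= xS|x [n _] /=].
      by have [n cn] := ltr_add_invr xS; exists n.
    by apply: lt_trans; rewrite ltrDl.
  apply: measure_bigcup_eq0 => // n.
  have n0 : 0 < n.+1%:R^-1 :> R by rewrite invr_gt0.
  have [x Sx xn] := inf_adherent n0 hiS.
  apply/eqP; rewrite eq_le measure_ge0 andbT -Sx.
  by apply: le_measure; rewrite ?inE// => y /=; exact: lt_trans.
have -> : [set inf S] = ~` ([set x | x < inf S] `|` [set x | inf S < x]).
  apply/seteqP; split => x /=; first by move=> ->; rewrite ltxx; case.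
  by move=> /not_orP[/negP + /negP]; rewrite -!leNgt => h1 h2; apply/eqP; rewrite eq_le h1 h2.
have mlt : measurable [set x : R | x < inf S] by rewrite -set_itvNyo; exact: measurable_itv.
rewrite probability_setC//; last exact: measurableU.
have -> : F0 ([set x | x < inf S] `|` [set x | inf S < x]) = 0%E.
  by rewrite (measureU0 (mu := F0)).
by rewrite sube0.
Qed.

End Separation.

(** * The weighted counting test *)

Section Detection.
Context {R : realType} (F0 : probability R R).

Lemma Ftheta_setE (t : R) (Q : probability R R) (B : set R) :
  (mgf F0 t < +oo)%E -> (Q : set R -> \bar R) = Ftheta F0 t -> measurable B ->
  (Q B = \int[F0]_x ((\1_B x)%:E * (lr F0 t x)%:E))%E.
Proof.
move=> fin QE mB.
have mI : measurable_fun setT (fun x => (\1_B x)%:E : \bar R).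
  by apply/measurable_EFinP; exact: measurable_indic.
rewrite -(integral_Ftheta fin mI) => [|x]; last by rewrite lee_fin indicE.
by rewrite -QE integral_indic// setIT.
Qed.

(* Comparing the density with its value at [c] on both sides of [c] gives
   q >= K (p + t d r) and 1 - q <= K (1 - p) with the same constant K. *)
Lemma tilted_ray_ge (t c d p r q : R) (Q : probability R R) :
  0 < t -> 0 < d -> (mgf F0 t < +oo)%E -> (Q : set R -> \bar R) = Ftheta F0 t ->
  F0 [set x | c < x] = p%:E -> F0 [set x | c + d <= x] = r%:E ->
  Q [set x | c < x] = q%:E -> p < 1 ->
  (1 - p) * ((t * d * r) / (1 + t * d * r)) <= q - p.
Proof.
move=> t0 d0 fin QE Ap Ar Qq p1; set A := [set x | c < x] in Ap Qq.
set A' := [set x | c + d <= x] in Ar.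
have mA : measurable A by rewrite /A -set_itvoy; exact: measurable_itv.
have mA' : measurable A' by rewrite /A' -set_itvcy; exact: measurable_itv.
have mAc : measurable (~` A) by exact: measurableC.
pose K := lr F0 t c; have K0 : 0 < K by exact: expR_gt0.
have td0 : 0 <= t * d by rewrite mulr_ge0// ltW.
have r0 : 0 <= r by rewrite -lee_fin -Ar.
have p0 : 0 <= p by rewrite -lee_fin -Ap.
have q0 : 0 <= q by rewrite -lee_fin -Qq.
have lrK x : lr F0 t x = K * expR (t * (x - c)).
  by rewrite /K /lr -expRD; congr expR; ring.
have mI (B : set R) : measurable B -> measurable_fun setT (fun x => (\1_B x)%:E : \bar R).
  by move=> mB; apply/measurable_EFinP; exact: measurable_indic.
have mL : measurable_fun setT (fun x => (lr F0 t x)%:E).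
  by apply/measurable_EFinP; exact: measurable_lr.
have I0 (B : set R) x : 0 <= (\1_B x : R) by rewrite indicE.
have lo : K * (p + t * d * r) <= q.
  rewrite -lee_fin -Qq (Ftheta_setE fin QE mA).
  have -> : ((K * (p + t * d * r))%:E =
      \int[F0]_x (K%:E * (\1_A x)%:E + (K * (t * d))%:E * (\1_A' x)%:E))%E.
    rewrite ge0_integralD//; last 4 first.
    - by move=> x _; rewrite mule_ge0 ?lee_fin// ltW.
    - by apply: emeasurable_funM; [exact: measurable_cst|exact: mI].
    - by move=> x _; rewrite mule_ge0 ?lee_fin// mulr_ge0// ltW.
    - by apply: emeasurable_funM; [exact: measurable_cst|exact: mI].
    rewrite ge0_integralZl ?lee_fin//; [|exact: mI|exact: ltW].
    rewrite ge0_integralZl ?lee_fin//; [|exact: mI|by rewrite mulr_ge0// ltW].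
    transitivity (K%:E * F0 A + (K * (t * d))%:E * F0 A')%E.
      by rewrite Ap Ar -!EFinM -EFinD; congr EFin; ring.
    by congr (_ * _ + _ * _)%E; rewrite integral_indic// setIT.
  apply: ge0_le_integral => //.
  - by move=> x _; rewrite adde_ge0// mule_ge0 ?lee_fin// ?mulr_ge0// ltW.
  - by apply: emeasurable_funD; apply: emeasurable_funM; [exact: measurable_cst|exact: mI|exact: measurable_cst|exact: mI].
  - by apply: emeasurable_funM => //; exact: mI.
  move=> x _; rewrite -!EFinM -EFinD lee_fin lrK !indicE.
  have [|nA] := boolP (x \in A).
    rewrite inE /A /= => cx; rewrite mulr1 mul1r -mulrA -{1}[K]mulr1 -mulrDr ler_pM2l//.
    apply: le_trans (expR_ge1Dx _); rewrite lerD2l.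
    have [|_] := boolP (x \in A'); last first.
      by rewrite mulr0 mulr_ge0 ?ltW// subr_gt0.
    by rewrite inE /A' /= mulr1 => cdx; rewrite ler_pM2l// lerBrDl.
  have -> : (x \in A') = false.
    apply/negbTE; apply: contra nA; rewrite !inE /A /A' /=.
    by apply: lt_le_trans; rewrite ltrDl.
  by rewrite !mulr0 mul0r addr0.
have hi : 1 - q <= K * (1 - p).
  have -> : (1 - q) = fine (Q (~` A)) by rewrite probability_setC// Qq.
  have QAc : Q (~` A) \is a fin_num by rewrite probability_setC// Qq.
  rewrite -lee_fin fineK// (Ftheta_setE fin QE mAc).
  have -> : ((K * (1 - p))%:E = \int[F0]_x (K%:E * (\1_(~` A) x)%:E))%E.
    rewrite ge0_integralZl ?lee_fin//; [|exact: mI|exact: ltW].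
    transitivity (K%:E * F0 (~` A))%E; first by rewrite probability_setC// Ap.
    by congr (_ * _)%E; rewrite integral_indic// setIT.
  apply: ge0_le_integral => //.
  - by move=> x _; rewrite mule_ge0 ?lee_fin// expR_ge0.
  - by apply: emeasurable_funM => //; exact: mI.
  - by apply: emeasurable_funM; [exact: measurable_cst|exact: mI].
  move=> x _; rewrite -!EFinM lee_fin lrK !indicE in_setC.
  have [|] := boolP (x \in A); first by rewrite mul0r mulr0.
  rewrite notin_setE /A /= => /negP; rewrite -leNgt => xc.
  rewrite mul1r mulr1 -[leRHS]mulr1 ler_pM2l// expR_le1.
  by rewrite mulr_ge0_le0 ?subr_le0// ltW.
have q1 : q <= 1 by rewrite -lee_fin -Qq probability_le1.
set s := t * d * r in lo *.
have s0 : 0 <= s by rewrite mulr_ge0.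
have s1 : 0 < 1 + s by rewrite ltr_pwDl.
(* Eliminating K between the two bounds leaves a linear inequality in q, whose solution is the
   claim. *)
have key : (1 - q) * (p + s) <= q * (1 - p).
  have h1 : (1 - q) * (p + s) <= K * (1 - p) * (p + s).
    by apply: ler_wpM2r => //; rewrite addr_ge0.
  apply: (le_trans h1); rewrite mulrAC; apply: ler_wpM2r => //.
  by rewrite subr_ge0 ltW.
rewrite mulrA ler_pdivrMr//; nra.
Qed.

(** Level i has at most 2 i + 1 vertices, each of squared weight 1 / (i + 1)^2, and 2 i + 1 <= 2 (i
    + 1). *)
Lemma inverse_square_level_sum m :
  \sum_(k < nV m) (((vert m k).1.+1%:R)^-1) ^+ 2 <=
  2 * \sum_(i < m) (i.+1%:R)^-1 :> R.
Proof.
have := @sum_level_le R m (fun i => (i.+1%:R)^-1 ^+ 2) (fun i => sqr_ge0 _).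
move=> /le_trans; apply; rewrite mulr_sumr; apply: ler_sum => i _.
have i0 : 0 < i.+1%:R :> R by rewrite ltr0n.
rewrite expr2 -mulrA [leRHS]mulrC; apply: ler_wpM2l; first by rewrite invr_ge0 ltW.
rewrite mulrC ler_pdivrMr// -natrM ler_nat; lia.
Qed.

Variables (c d p r : R).
Hypotheses (d_gt0 : 0 < d) (Fp : F0 [set x | c < x] = p%:E) (p_lt1 : p < 1).
Hypotheses (Fr : F0 [set x | c + d <= x] = r%:E) (r_gt0 : 0 < r).

Let A := [set x : R | c < x].

Let mA : measurable A.
Proof. by rewrite /A -set_itvoy; exact: measurable_itv. Qed.

Definition weight m k : R := (((vert m k).1).+1%:R)^-1.

(** The gain in mean of an on-path indicator guaranteed by [tilted_ray_ge]. *)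
Definition shift_lb (t : R) : R := (1 - p) * ((t * d * r) / (1 + t * d * r)).

(** The statistic has mean 0 under [F0]; the threshold is half the mean guaranteed under every
    alternative. *)
Definition count_test m (t : R) (x : (nV m).-tuple R) : bool :=
  shift_lb t * (\sum_(i < m) (i.+1%:R)^-1) / 2 <
  \sum_(k < nV m) weight m k * (\1_A (tnth x k) - p).

Lemma is_test_count_test m t : is_test (count_test t (m := m)).
Proof.
apply: measurable_fun_ltr; first exact: measurable_cst.
exact: (measurable_weighted_count (weight m) (fun=> p) mA).
Qed.

(** Either error forces a deviation of at least D H / 2 from the mean, while the squared weights sum
    to at most 2 H; Chebyshev bounds each error by 2 H / (D H / 2)^2 = 8 / (D^2 H). *)
Lemma risk_count_test m t : (0 < m)%N -> 0 < t -> (mgf F0 t < +oo)%E ->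
  (risk F0 t (count_test t (m := m)) <=
    (16 / (shift_lb t ^+ 2 * \sum_(i < m) (i.+1%:R)^-1))%:E)%E.
Proof.
move=> m0 t0 fin; set H := \sum_(i < m) (i.+1%:R)^-1.
have H0 : 0 < H.
  rewrite /H (bigD1 (Ordinal m0))//= ltr_pwDl ?invr_gt0//.
  by apply: sumr_ge0 => i _; rewrite invr_ge0.
have s0 : 0 < t * d * r by rewrite !mulr_gt0.
have D0 : 0 < shift_lb t.
  by rewrite mulr_gt0 ?subr_gt0// divr_gt0// addr_gt0.
set D := shift_lb t in D0 *.
have h0 : 0 < D * H / 2 by rewrite divr_gt0// mulr_gt0.
have half (T : (nV m).-tuple R -> bool) (mu : nat -> probability R R) (q : nat -> R) :
    measurable_fun setT T -> (forall k, mu k A = (q k)%:E) ->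
    (forall x, T x -> D * H / 2 <= `|\sum_(k < nV m) weight m k * (\1_A (tnth x k) - q k)|) ->
    (iint (fun k => mu k : set R -> \bar R) (fun x => ind R (T x)) <=
      (8 / (D ^+ 2 * H))%:E)%E.
  move=> mT muq Th.
  have := iint_chebyshev mA muq h0 (inverse_square_level_sum m) mT Th.
  move=> /le_trans; apply; rewrite lee_fin -/H le_eqVlt; apply/orP; left; apply/eqP.
  by field; rewrite !gt_eqF.
have -> : 16 / (D ^+ 2 * H) = 8 / (D ^+ 2 * H) + 8 / (D ^+ 2 * H).
  by rewrite -mulrDl -natrD.
have mT : is_test (count_test t (m := m)) by exact: is_test_count_test.
rewrite EFinD; apply: leeD.
  apply: (half _ (fun=> F0) (fun=> p)) => // x.
  rewrite /count_test -/H -/D => /ltW hx; apply: (le_trans hx).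
  exact: ler_norm.
apply: ge_ereal_sup => _ [pth pm <-].
have [Q QE] := Ftheta_probability fin.
have [q Qq] : exists q, Q A = q%:E.
  by exists (fine (Q A)); rewrite fineK// fin_num_measure.
have Dq : D <= q - p by exact: (tilted_ray_ge t0 d_gt0 fin QE Fp Fr Qq p_lt1).
pose on k := on_path pth (vert m k).
pose mu k : probability R R := if on k then Q else F0.
pose qq k : R := if on k then q else p.
rewrite (@eq_iint _ _ _ (fun k => mu k : set R -> \bar R) _
  (fun x => ind R (~~ count_test t x)))//; last first.
  by move=> k _; rewrite /law1 /mu /on; case: on_path.
apply: (half _ mu qq).
- exact: (measurableT_comp (f := negb)).
- by move=> k; rewrite /mu /qq; case: (on k).
move=> x; rewrite /count_test -/H -/D -leNgt => hx.
have -> : \sum_(k < nV m) weight m k * (\1_A (tnth x k) - qq k) =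
    \sum_(k < nV m) weight m k * (\1_A (tnth x k) - p) - (q - p) * H.
  (* Every path collects the same total weight H, one vertex per level, so recentring subtracts (q -
     p) H whatever the path. *)
  have -> : H = \sum_(k < nV m | on k) weight m k.
    by rewrite (@sum_on_path _ m pth (fun v => (v.1.+1%:R)^-1)).
  rewrite [X in _ * X]big_mkcond /= mulr_sumr -sumrB; apply: eq_bigr => k _.
  by rewrite /qq; case: (on k); ring.
rewrite ler_normr; apply/orP; right.
have : D * H <= (q - p) * H by rewrite ler_pM2r.
by move: hx; set S := \sum_(k < nV m) _; lra.
Qed.

End Detection.

(** * Consistency of the counting test *)

Section UpperBound.
Context {R : realType} (F0 : probability R R).

Lemma law1_probability m (t : R) p : (mgf F0 t < +oo)%E ->
  exists mu : nat -> probability R R,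
    law1 F0 m t p = (fun k => mu k : set R -> \bar R).
Proof.
move=> fin; have [Q QE] := Ftheta_probability fin.
exists (fun k => if on_path p (vert m k) then Q else F0).
by apply/funext => k; rewrite /law1 -QE; case: on_path.
Qed.

Lemma risk_ge0 m (t : R) T : (mgf F0 t < +oo)%E -> (0 <= @risk R F0 m t T)%E.
Proof.
move=> fin; have ind0 b : (0 <= ind R b)%E by rewrite lee_fin.
apply: adde_ge0; first by apply: (iint_ge0 (fun=> F0)) => x.
(* The straight path shows that the supremum ranges over a nonempty set of nonnegative values. *)
pose p (i : nat) := i%:Z.
have pm : is_path m p by split => // i _; rewrite /p intS addrK.
apply: ereal_sup_ge; exists (iint (law1 F0 m t p) (fun x => ind R (~~ T x))).
  by exists p.
have [mu ->] := law1_probability m p fin.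
by apply: iint_ge0 => x.
Qed.

Lemma detection_possible (theta : nat -> R) :
  ~ (exists c : R, F0 [set c] = 1%E) -> (forall m, 0 < theta m) ->
  (forall m, (mgf F0 (theta m) < +oo)%E) ->
  (fun m => theta m * Num.sqrt (ln (m%:R))) @ \oo --> +oo ->
  exists T : forall m : nat, (nV m).-tuple R -> bool,
    (forall m, is_test (T m)) /\
    (fun m => risk F0 (theta m) (T m)) @ \oo --> 0%E.
Proof.
move=> nondeg t0 fin tinf; have [c [Flo Fhi]] := nondegenerate_split nondeg.
have [d d0 Fd] := measure_ray_open Fhi.
have mA : measurable [set x : R | c < x] by rewrite -set_itvoy; exact: measurable_itv.
have mA' : measurable [set x : R | c + d <= x] by rewrite -set_itvcy; exact: measurable_itv.
have [p Fp] : exists p, F0 [set x | c < x] = p%:E.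
  by eexists; rewrite -[LHS]fineK// fin_num_measure.
have [r Fr] : exists r, F0 [set x | c + d <= x] = r%:E.
  by eexists; rewrite -[LHS]fineK// fin_num_measure.
have r0 : 0 < r by rewrite -lte_fin -Fr.
have p1 : p < 1.
  have AE : ~` [set x : R | c < x] = [set x | x <= c].
    by apply/seteqP; split => x /=; rewrite leNgt; move/negP.
  by move: Flo; rewrite -AE probability_setC// Fp -EFinB lte_fin subr_gt0.
exists (fun m => count_test c d p r (theta m) (m := m)); split.
  by move=> m; exact: is_test_count_test.
suff small e : 0 < e -> \forall m \near \oo,
    (risk F0 (theta m) (count_test c d p r (theta m) (m := m)) <= e%:E)%E.
  apply/fine_cvgP; split.
    near=> m; rewrite ge0_fin_numE; last exact: risk_ge0.
    apply: (@le_lt_trans _ _ 1%E); last exact: ltry.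
    by near: m; exact: small.
  apply/cvgrPdist_le => e e0; near=> m.
  have le_e : (risk F0 (theta m) (count_test c d p r (theta m) (m := m)) <= e%:E)%E.
    by near: m; exact: small.
  have ge_0 : (0 <= risk F0 (theta m) (count_test c d p r (theta m) (m := m)))%E.
    exact: risk_ge0.
  rewrite sub0r normrN /= ger0_norm ?fine_ge0//.
  by rewrite -lee_fin fineK// ge0_fin_numE// (le_lt_trans le_e)// ltry.
move=> e0; have p1' : 0 < 1 - p by rewrite subr_gt0.
(* M satisfies ((1 - p) M / 2)^2 = 16 / e, the size of D^2 H that makes the bound of
   [risk_count_test] at most e. *)
pose M := 8 / ((1 - p) * Num.sqrt e).
have se0 : 0 < Num.sqrt e by rewrite sqrtr_gt0.
have M0 : 0 < M by rewrite divr_gt0// mulr_gt0.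
near=> m.
have m_gt0 : (0 < m)%N by near: m; exact: nbhs_infty_gt.
have tM : M / (d * r) <= theta m * Num.sqrt (ln m%:R).
  by near: m; move/cvgryPge : tinf; apply.
have mM : expR (M ^+ 2) <= m%:R by near: m; exact: nbhs_infty_ger.
have mR : 0 < m%:R :> R by rewrite ltr0n.
have lnM2 : M ^+ 2 <= ln m%:R by rewrite -ler_expR lnK// posrE.
have ln0 : 0 <= ln m%:R :> R by apply: le_trans lnM2; exact: sqr_ge0.
set x := Num.sqrt (ln m%:R) in tM.
have xM : M <= x by rewrite -(ger0_norm (ltW M0)) -sqrtr_sqr ler_wsqrtr.
have x0 : 0 < x by exact: lt_le_trans xM.
apply: (le_trans (risk_count_test d0 Fp p1 Fr r0 m_gt0 (t0 m) (fin m))).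
set H := \sum_(i < m) _; have xH : x ^+ 2 <= H.
  rewrite sqr_sqrtr//; apply: le_trans (ln_le_harmonic m).
  by rewrite ler_ln ?posrE// ler_nat.
rewrite lee_fin /shift_lb; set s := theta m * d * r.
have s0 : 0 < s by rewrite !mulr_gt0.
have s1 : 0 < 1 + s by rewrite addr_gt0.
have sx : M <= s * x.
  rewrite (_ : s * x = theta m * x * (d * r)); last by rewrite /s; ring.
  by rewrite -ler_pdivrMr// mulr_gt0.
set D := (1 - p) * (s / (1 + s)).
(* From s x >= M and x >= M follows s x / (1 + s) >= M / 2, whether s is small or large. *)
have Dx : (1 - p) * (M / 2) <= D * x.
  rewrite /D -mulrA; apply: ler_wpM2l; first exact: ltW.
  rewrite [leRHS]mulrAC ler_pdivlMr//.
  have : M * s <= x * s by rewrite ler_pM2r.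
  by move: sx; clearbody M; lra.
have D0 : 0 < D by rewrite !mulr_gt0// invr_gt0.
have D2H : 16 / e <= D ^+ 2 * H.
  have -> : 16 / e = ((1 - p) * (M / 2)) ^+ 2.
    rewrite -{1}(sqr_sqrtr (ltW e0)) /M; field.
    by rewrite !gt_eqF.
  apply: (@le_trans _ _ ((D * x) ^+ 2)).
    have L0 : 0 <= (1 - p) * (M / 2) by rewrite ltW// mulr_gt0// divr_gt0.
    by rewrite ler_pXn2r// nnegrE (le_trans L0 Dx).
  by rewrite exprMn ler_pM2l// exprn_gt0.
have P0 : 0 < D ^+ 2 * H by apply: lt_le_trans D2H; rewrite divr_gt0.
by rewrite ler_pdivrMr// mulrC -ler_pdivrMr.
Unshelve. all: by end_near. Qed.

End UpperBound.

(** * Impossibility *)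

Section ChangeOfMeasure.
Context {R : realType}.

Lemma iint_change_of_measure (n : nat) (mu nu : nat -> probability R R)
    (g : nat -> R -> \bar R) (f : n.-tuple R -> \bar R) :
  (forall k, measurable_fun setT (g k)) -> (forall k x, 0 <= g k x)%E ->
  (forall k (h : R -> \bar R), measurable_fun setT h -> (forall x, 0 <= h x)%E ->
    (\int[nu k]_x h x = \int[mu k]_x (h x * g k x))%E) ->
  measurable_fun setT f -> (forall t, 0 <= f t)%E ->
  (iint (fun k => nu k : set R -> \bar R) f =
   iint (fun k => mu k : set R -> \bar R)
     (fun t => f t * \prod_(k < n) g k (tnth t k)))%E.
Proof.
elim: n mu nu g f => [|n IHn] mu nu g f mg g0 numu mf f0 /=.
  by rewrite big_ord0 mule1.
rewrite numu; first last.
- by move=> x; apply: (iint_ge0 (fun k => nu k.+1)) => t.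
- exact: (measurable_iint_cons (fun k => nu k.+1)).
apply: eq_integral => x _.
rewrite (IHn (fun k => mu k.+1) (fun k => nu k.+1) (fun k => g k.+1) _
  (fun k => mg k.+1) (fun k => g0 k.+1) (fun k => numu k.+1)
  (measurable_tuple_tail x mf) (fun t => f0 _)).
rewrite muleC -(iintZl (fun k => mu k.+1))//; first last.
- by move=> t; rewrite mule_ge0// prode_ge0.
- apply: emeasurable_funM; first exact: measurable_tuple_tail.
  exact: (@measurable_prod_tnth _ n (fun k => g k.+1)).
apply: eq_iint => // t; rewrite big_ord_recl /= muleCA.
by congr (_ * (_ * _))%E; apply: eq_bigr => k _; rewrite tnthS.
Qed.

End ChangeOfMeasure.

(** * Likelihood ratios and the Bayes lower bound on the risk *)

Section SecondMoment.
Context {R : realType} (F0 : probability R R).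
Variables (m : nat) (t l : R).
Hypotheses (fin : (mgf F0 t < +oo)%E) (l_ge0 : 0 <= l).
(** Thus [l] is the chi-square divergence of the tilted law from [F0]. *)
Hypothesis lr2 : (\int[F0]_x ((lr F0 t x) ^+ 2)%:E = (1 + l)%:E)%E.

Let lr_at (p : nat -> int) (k : nat) (x : R) : R :=
  if on_path p (vert m k) then lr F0 t x else 1.

Let lr_at_ge0 p k x : 0 <= lr_at p k x.
Proof. by rewrite /lr_at; case: ifP => // _; exact: lr_ge0. Qed.

Let measurable_lr_at p k : measurable_fun setT (lr_at p k).
Proof. by rewrite /lr_at; case: on_path => //; exact: measurable_lr. Qed.

Definition path_lr (p : nat -> int) (x : (nV m).-tuple R) : R :=
  \prod_(k < nV m) lr_at p k (tnth x k).

Lemma path_lr_ge0 p x : 0 <= path_lr p x.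
Proof. by apply: prodr_ge0 => k _; exact: lr_at_ge0. Qed.

Lemma path_lrE p x :
  ((path_lr p x)%:E = \prod_(k < nV m) (lr_at p k (tnth x k))%:E)%E.
Proof. by rewrite /path_lr -prodEFin. Qed.

Lemma measurable_path_lr p : measurable_fun setT (path_lr p).
Proof.
apply/measurable_EFinP.
have -> : EFin \o path_lr p = (fun x => \prod_(k < nV m) (lr_at p k (tnth x k))%:E)%E.
  by apply/funext => x /=; exact: path_lrE.
apply: (@measurable_prod_tnth _ (nV m) (fun k x => (lr_at p k x)%:E)) => k.
exact/measurable_EFinP.
Qed.

Lemma iint_law1 p (f : (nV m).-tuple R -> \bar R) :
  measurable_fun setT f -> (forall x, 0 <= f x)%E ->
  (iint (law1 F0 m t p) f = iint (law0 F0) (fun x => f x * (path_lr p x)%:E))%E.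
Proof.
move=> mf f0; have [mu muE] := law1_probability m p fin; rewrite muE.
rewrite (@iint_change_of_measure _ _ (fun=> F0) mu (fun k x => (lr_at p k x)%:E))//.
- by apply: eq_iint => // x; rewrite path_lrE.
- by move=> k; exact/measurable_EFinP.
- by move=> k x; rewrite lee_fin.
move=> k h mh h0; have -> : (mu k : set R -> \bar R) = law1 F0 m t p k by rewrite muE.
rewrite /law1 /lr_at; case: on_path; first exact: integral_Ftheta.
by apply: eq_integral => x _; rewrite mule1.
Qed.

Lemma iint_path_lr p : (iint (law0 F0) (fun x => (path_lr p x)%:E) = 1)%E.
Proof.
have := @iint_law1 p (fun=> 1%E) (measurable_cst _) (fun=> lee01).
have [mu ->] := law1_probability m p fin.
rewrite iint_cst// => ->.
by apply: eq_iint => // x; rewrite mul1e.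
Qed.

(** By independence the integral factors over vertices: a common vertex gives 1 + l, a vertex on one
    path only gives the total mass 1 of the tilted law, any other gives 1. Common vertices
    correspond to meeting times. *)
Lemma iint_path_lrM p q : is_path m p ->
  (iint (law0 F0) (fun x => (path_lr p x * path_lr q x)%:E) =
   ((1 + l) ^+ meets p q m)%:E)%E.
Proof.
move=> pm.
transitivity (iint (fun=> F0 : set R -> \bar R) (fun x : (nV m).-tuple R =>
    \prod_(k < nV m) (lr_at p k (tnth x k) * lr_at q k (tnth x k))%:E))%E.
  by apply: eq_iint => // x; rewrite /path_lr -big_split /= prodEFin.
rewrite (@iint_prod _ (nV m) (fun=> F0) (fun k x => (lr_at p k x * lr_at q k x)%:E)); last 2 first.
- by move=> k; apply/measurable_EFinP; exact: measurable_funM.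
- by move=> k x; rewrite lee_fin mulr_ge0.
have -> : meets p q m =
    (\sum_(k < nV m) (on_path p (vert m k) && on_path q (vert m k)))%N.
  rewrite /meets; have := @sum_on_path nat m p (fun v => on_path q v : nat) pm.
  rewrite /on_path /= => <-.
  by rewrite big_mkcond; apply: eq_bigr => k _; case: (_ == p _).
rewrite -prodrXr -prodEFin; apply: eq_bigr => k _; rewrite /lr_at.
case: (on_path p _); case: (on_path q _) => /=.
- by rewrite expr1 -lr2; apply: eq_integral => x _; rewrite expr2.
- by rewrite -[RHS](integral_lr fin); apply: eq_integral => x _; rewrite mulr1.
- by rewrite -[RHS](integral_lr fin); apply: eq_integral => x _; rewrite mul1r.
by rewrite mulr1 integral_cst// mul1e [LHS](probability_setT F0).
Qed.

Variable L : nat.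
Hypotheses (L_gt0 : (0 < L)%N) (mL : (m.+1 <= 2 ^ L)%N).

(** The likelihood ratio of the mixture in which the path is the walk with uniform seeds. *)
Let mix_lr (x : (nV m).-tuple R) : R := mean (fun w : seeds m L => path_lr (walk w) x).

Let measurable_mix_lr : measurable_fun setT mix_lr.
Proof.
apply: measurable_funM => //; apply: measurable_sum => w.
exact: measurable_path_lr.
Qed.

Let mix_lr_ge0 x : 0 <= mix_lr x.
Proof. by apply: mean_ge0 => w; exact: path_lr_ge0. Qed.

Lemma iint_mean (f : seeds m L -> (nV m).-tuple R -> R) (g : seeds m L -> R) :
  (forall w, measurable_fun setT (f w)) -> (forall w x, 0 <= f w x) ->
  (forall w, iint (law0 F0) (fun x => (f w x)%:E) = (g w)%:E)%E ->
  (iint (law0 F0) (fun x => (mean (fun w => f w x))%:E) = (mean g)%:E)%E.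
Proof.
move=> mf f0 fg.
have mf' w : measurable_fun setT (fun x => (f w x)%:E) by exact/measurable_EFinP.
have c0 : (0 <= ((#|{: seeds m L}|%:R)^-1%:E : \bar R))%E by rewrite lee_fin invr_ge0.
transitivity (iint (fun=> F0 : set R -> \bar R) (fun x =>
    ((#|{: seeds m L}|%:R)^-1)%:E * \sum_w (f w x)%:E))%E.
  by apply: eq_iint => // x; rewrite /mean EFinM sumEFin.
rewrite (iintZl (fun=> F0))//; last 2 first.
- exact: emeasurable_sum.
- by move=> x; apply: sume_ge0 => w _; rewrite lee_fin.
rewrite (iint_sum (fun=> F0))//.
rewrite /mean EFinM -sumEFin; congr (_ * _)%E.
by apply: eq_bigr => w _; exact: fg.
Qed.

Lemma iint_mix_lr : (iint (law0 F0) (fun x => (mix_lr x)%:E) = 1)%E.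
Proof.
rewrite (iint_mean (g := fun=> 1)) ?mean_cst//.
- by move=> w; exact: measurable_path_lr.
- by move=> w x; exact: path_lr_ge0.
- by move=> w; exact: iint_path_lr.
Qed.

(** The square of the mixture ratio is a double average over two independent walks; the meeting
    bound applies for each fixed second walk. *)
Lemma iint_mix_lr2 (A : R) :
  \sum_(k < m) predictability R L k <= A -> l * A < 1 ->
  (iint (law0 F0) (fun x => (mix_lr x ^+ 2)%:E) <= ((1 - l * A)^-1)%:E)%E.
Proof.
move=> pA lA.
pose G w w' : R := (1 + l) ^+ meets (walk (w : seeds m L)) (walk (w' : seeds m L)) m.
have -> : (iint (law0 F0) (fun x => (mix_lr x ^+ 2)%:E) =
    (mean (fun w' => mean (fun w => G w w')))%:E)%E.
  pose f (w' : seeds m L) x :=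
    mean (fun w : seeds m L => path_lr (walk w) x * path_lr (walk w') x).
  rewrite -(iint_mean (f := f)).
  - apply: eq_iint => // x; rewrite expr2 {1}/mix_lr -meanZl.
    congr (_%:E); congr mean; apply/funext => w'.
    by rewrite mulrC -meanZl; congr mean; apply/funext => w; rewrite mulrC.
  - move=> w'; apply: measurable_funM => //; apply: measurable_sum => w.
    by apply: measurable_funM; exact: measurable_path_lr.
  - by move=> w' x; apply: mean_ge0 => w; rewrite mulr_ge0// path_lr_ge0.
  move=> w'; apply: iint_mean.
  - by move=> w; apply: measurable_funM; exact: measurable_path_lr.
  - by move=> w x; rewrite mulr_ge0// path_lr_ge0.
  - by move=> w; apply: iint_path_lrM; exact: is_path_walk.
rewrite lee_fin -[leRHS](@mean_cst R m L); apply: le_mean => w'.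
by apply: mean_meets_le => //; rewrite leqW// leqW.
Qed.

(** The supremum over paths dominates the average over walks, so the minimax risk is at least the
    Bayes risk. *)
Lemma risk_ge_mix (T : (nV m).-tuple R -> bool) : is_test T ->
  (iint (law0 F0) (fun x => ((T x)%:R + (~~ T x)%:R * mix_lr x)%:E) <= risk F0 t T)%E.
Proof.
move=> mT; have mind := measurable_ind mT.
have mnT : measurable_fun setT (fun x => ~~ T x).
  exact: (measurableT_comp (f := negb)).
have mindN := measurable_ind mnT.
have ind0 b : (0 <= ind R b)%E by rewrite lee_fin.
have -> : (iint (law0 F0) (fun x => ((T x)%:R + (~~ T x)%:R * mix_lr x)%:E) =
  iint (law0 F0) (fun x => ind R (T x)) +
  iint (law0 F0) (fun x => ind R (~~ T x) * (mix_lr x)%:E))%E.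
  rewrite -(iintD (fun=> F0))//; last 2 first.
  - by apply: emeasurable_funM => //; exact/measurable_EFinP.
  - by move=> x; rewrite mule_ge0// lee_fin.
apply: leeD => //.
set S := ereal_sup _.
have c0 : (0 <= ((#|{: seeds m L}|%:R)^-1%:E : \bar R))%E by rewrite lee_fin invr_ge0.
have mP w : measurable_fun setT
    (fun x => ind R (~~ T x) * (path_lr (walk (w : seeds m L)) x)%:E)%E.
  by apply: emeasurable_funM => //; apply/measurable_EFinP; exact: measurable_path_lr.
have P0 (w : seeds m L) x : (0 <= ind R (~~ T x) * (path_lr (walk w) x)%:E)%E.
  by rewrite mule_ge0// lee_fin path_lr_ge0.
have -> : (iint (law0 F0) (fun x => ind R (~~ T x) * (mix_lr x)%:E) =
   (#|{: seeds m L}|%:R)^-1%:E * \sum_(w : seeds m L)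
     iint (law0 F0) (fun x => ind R (~~ T x) * (path_lr (walk w) x)%:E))%E.
  rewrite -(iint_sum (fun=> F0))// -(iintZl (fun=> F0))//; last 2 first.
  - exact: emeasurable_sum.
  - by move=> x; exact: sume_ge0.
  apply: eq_iint => // x; rewrite /mix_lr /mean EFinM -sumEFin muleCA.
  by rewrite ge0_sume_distrr// => w _; rewrite lee_fin path_lr_ge0.
apply: (@le_trans _ _ ((#|{: seeds m L}|%:R)^-1%:E * \sum_(w : seeds m L) S)%E).
  apply: lee_wpmul2l => //; apply: lee_sum => w _.
  rewrite -iint_law1//; apply: ereal_sup_ubound.
  by exists (walk w) => //; exact: is_path_walk.
have n0 := card_seeds_gt0 R m L.
have -> : (\sum_(w : seeds m L) S = (#|{: seeds m L}|%:R)%:E * S)%E.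
  by rewrite mule_natl sumr_const.
rewrite muleA.
by rewrite -EFinM mulVf ?gt_eqF// mul1e.
Qed.

(** Pointwise T + (1 - T) y >= 1 - e - (1 - y)^2 / (4 e) for the mixture ratio y, by AM-GM. Since y
    has mean 1, the mean of (1 - y)^2 is its second moment minus 1. *)
Lemma risk_lower_bound (A e : R) (T : (nV m).-tuple R -> bool) : is_test T ->
  \sum_(k < m) predictability R L k <= A -> l * A < 1 -> 0 < e ->
  ((1 - e - ((1 - l * A)^-1 - 1) / (4 * e))%:E <= risk F0 t T)%E.
Proof.
move=> mT pA lA e0; apply: le_trans (risk_ge_mix mT).
have S1 := iint_mix_lr2 pA lA; set S := (1 - l * A)^-1 in S1 *.
set B := iint _ (fun x => (_ + _ * _)%:E).
pose eta := (4 * e)^-1; have eta0 : 0 < eta by rewrite invr_gt0 mulr_gt0.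
have mT' : measurable_fun setT (fun x => (T x)%:R : R).
  exact: (measurableT_comp (f := fun b : bool => b%:R : R)).
have mnT' : measurable_fun setT (fun x => (~~ T x)%:R : R).
  exact: (measurableT_comp (f := fun b : bool => (~~ b)%:R : R)).
have mB : measurable_fun setT (fun x => (T x)%:R + (~~ T x)%:R * mix_lr x).
  by apply: measurable_funD => //; apply: measurable_funM.
have B0 x : 0 <= (T x)%:R + (~~ T x)%:R * mix_lr x by rewrite addr_ge0// mulr_ge0.
have mE (f : (nV m).-tuple R -> R) : measurable_fun setT f ->
  measurable_fun setT (fun x => (f x)%:E) by move=> ?; exact/measurable_EFinP.
have m2 : measurable_fun setT (fun x => (mix_lr x ^+ 2)%:E).
  by apply: mE; exact: measurable_funX.
(* The pointwise bound is rearranged into nonnegative terms only, so that [le_iint] and [iintD]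
   apply. *)
have key : (iint (fun=> F0 : set R -> \bar R) (fun x => (1%:E + (2 * eta)%:E * (mix_lr x)%:E)) <=
    iint (fun=> F0 : set R -> \bar R) (fun x => ((T x)%:R + (~~ T x)%:R * mix_lr x)%:E +
      (eta%:E * (mix_lr x ^+ 2)%:E + (e + eta)%:E)))%E.
  apply: (le_iint (fun=> F0)).
  - apply: emeasurable_funD; first exact: measurable_cst.
    by apply: emeasurable_funM; [exact: measurable_cst|exact: mE].
  - by move=> x; rewrite adde_ge0// mule_ge0// lee_fin// mulr_ge0// ltW.
  - apply: emeasurable_funD; first exact: mE.
    apply: emeasurable_funD; last exact: measurable_cst.
    by apply: emeasurable_funM; first exact: measurable_cst.
  move=> x; rewrite -!EFinM -!EFinD lee_fin.
  have amgm y : 1 - y <= e + eta * (1 - y) ^+ 2.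
    have : 0 <= eta * (2 * e - (1 - y)) ^+ 2 by rewrite mulr_ge0 ?sqr_ge0// ltW.
    have -> : eta * (2 * e - (1 - y)) ^+ 2 =
        e + eta * (1 - y) ^+ 2 - (1 - y) by rewrite /eta; field; rewrite gt_eqF.
    by rewrite subr_ge0.
  have y0 := mix_lr_ge0 x; move: (mix_lr x) y0 => y y0.
  case: (T x) => /=.
    have : 0 <= eta * (1 - y) ^+ 2 by rewrite mulr_ge0 ?sqr_ge0// ltW.
    by rewrite mul0r addr0; clearbody eta; nra.
  by have := amgm y; rewrite mul1r add0r; clearbody eta; nra.
move: key.
rewrite (iintD (fun=> F0))//; first last.
- by move=> x; rewrite mule_ge0// lee_fin// mulr_ge0// ltW.
- by apply: emeasurable_funM; [exact: measurable_cst|exact: mE].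
rewrite (iintZl (fun=> F0))//; first last.
- exact: mE.
- by rewrite lee_fin mulr_ge0// ltW.
rewrite (iintD (fun=> F0))//; first last.
- by move=> x; rewrite adde_ge0// ?mule_ge0// lee_fin ?sqr_ge0// ?addr_ge0// ltW.
- apply: emeasurable_funD; last exact: measurable_cst.
  by apply: emeasurable_funM; first exact: measurable_cst.
- exact: mE.
rewrite (iintD (fun=> F0))//; first last.
- by move=> x; rewrite lee_fin addr_ge0// ltW.
- by move=> x; rewrite mule_ge0// lee_fin ?sqr_ge0// ltW.
- by apply: emeasurable_funM; first exact: measurable_cst.
rewrite (iintZl (fun=> F0))//; first last.
- by move=> x; rewrite lee_fin sqr_ge0.
- by rewrite lee_fin ltW.
rewrite (iint_cst _ (fun=> F0))//.
have ee : (0 <= (e + eta)%:E)%E by rewrite lee_fin addr_ge0// ltW.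
rewrite (iint_cst _ (fun=> F0) ee).
rewrite [X in (_ + _ * X)%E](_ : _ = 1%E); last exact: iint_mix_lr.
rewrite -[X in (_ <= X + _)%E]/B mule1 => key.
have {}key : ((1 + 2 * eta)%:E <= B + (eta * S + (e + eta))%:E)%E.
  apply: (le_trans key); apply: leeD => //; rewrite [leRHS]EFinD leeD2r//.
  by rewrite EFinM; apply: lee_wpmul2l => //; rewrite lee_fin ltW.
have -> : 1 - e - (S - 1) / (4 * e) = (1 + 2 * eta) - (eta * S + (e + eta)).
  by rewrite -/eta; ring.
by rewrite EFinB leeBlDr.
Qed.

End SecondMoment.

(** * Second moment of the likelihood ratio for small tilts *)

Section MomentGeneratingFunction.
Context {R : realType} (F0 : probability R R).

Lemma expR_norm_le (x : R) : expR `|x| <= expR x + expR (- x).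
Proof.
have [x0|/ltW x0] := leP 0 x; [rewrite ger0_norm// lerDl|rewrite ler0_norm// lerDr];
  exact: expR_ge0.
Qed.

Lemma expR_sub1_sqr_le (y : R) : (expR y - 1) ^+ 2 <= y ^+ 2 * expR (2 * `|y|).
Proof.
have -> : expR (2 * `|y|) = expR `|y| ^+ 2 by rewrite expRM_natl.
rewrite -exprMn -[leLHS]real_normK ?num_real// -[leRHS]real_normK ?num_real//.
rewrite ler_pXn2r ?nnegrE// normrM (ger0_norm (expR_ge0 _)).
have [y0|y0] := leP 0 y.
  rewrite (ger0_norm y0) ger0_norm; last by rewrite subr_ge0 -expR0 ler_expR.
  have : (1 - y) * expR y <= expR (- y) * expR y.
    by rewrite ler_wpM2r ?expR_ge0// expR_ge1Dx.
  by rewrite -[X in _ <= X]expRD addNr expR0; lra.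
rewrite (ltr0_norm y0) ler0_norm; last by rewrite subr_le0 -expR0 ler_expR ltW.
apply: (@le_trans _ _ (- y)); first by have := expR_ge1Dx y; lra.
rewrite -[leLHS]mulr1; apply: ler_wpM2l; first by rewrite oppr_ge0 ltW.
by rewrite -expR0 ler_expR oppr_ge0 ltW.
Qed.

(** This bounds (exp (t x) - 1)^2 by order t^2, expanded so that no subtraction is left and both
    sides integrate as nonnegative functions. *)
Lemma expR_second_order (d t x : R) : 0 < d -> 0 <= t -> t <= d / 4 ->
  expR (2 * t * x) + 1 <=
    2 * expR (t * x) + 16 / d ^+ 2 * t ^+ 2 * (expR (d * x) + expR (- d * x)).
Proof.
move=> d0 t0 td.
have h : (expR (t * x) - 1) ^+ 2 <=
    16 / d ^+ 2 * t ^+ 2 * (expR (d * x) + expR (- d * x)).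
  apply: (le_trans (expR_sub1_sqr_le _)).
  apply: (@le_trans _ _ (16 / d ^+ 2 * t ^+ 2 * expR (d * `|x|))); last first.
    apply: ler_wpM2l; first by rewrite mulr_ge0 ?sqr_ge0// divr_ge0// sqr_ge0.
    by have := expR_norm_le (d * x); rewrite normrM (gtr0_norm d0) mulNr.
  rewrite normrM (ger0_norm t0) exprMn -(real_normK (num_real x)).
  set a := `|x|; have a0 : 0 <= a by exact: normr_ge0.
  have -> : d * a = d / 2 * a + d / 2 * a by field.
  have -> : 16 / d ^+ 2 * t ^+ 2 * expR (d / 2 * a + d / 2 * a) =
      t ^+ 2 * ((16 / d ^+ 2 * expR (d / 2 * a)) * expR (d / 2 * a)).
    by rewrite expRD; ring.
  rewrite -[leLHS]mulrA; apply: ler_wpM2l; first exact: sqr_ge0.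
  (* Half of the exponent d |x| absorbs x^2, through |x| <= (4 / d) exp (d |x| / 4); the other half
     absorbs exp (2 t |x|), as 2 t <= d / 2. *)
  apply: ler_pM; rewrite ?sqr_ge0 ?expR_ge0//.
    have -> : d / 2 * a = 2 * (d / 4 * a) by field.
    rewrite expRM_natl.
    have -> : 16 / d ^+ 2 * expR (d / 4 * a) ^+ 2 = (4 / d * expR (d / 4 * a)) ^+ 2.
      by field; rewrite gt_eqF.
    have da0 : 0 <= d / 4 * a by rewrite mulr_ge0// divr_ge0// ltW.
    have d4 : 0 <= 4 / d by rewrite divr_ge0// ltW.
    have e0 : 0 <= 4 / d * expR (d / 4 * a) by rewrite mulr_ge0// expR_ge0.
    rewrite ler_pXn2r ?nnegrE//.
    rewrite mulrAC ler_pdivlMr// mulrC.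
    have := expR_ge1Dx (d / 4 * a); lra.
  by rewrite ler_expR mulrA ler_wpM2r//; lra.
have -> : expR (2 * t * x) = expR (t * x) ^+ 2 by rewrite -mulrA expRM_natl.
move: h; set C := 16 / _ * _ * _; set y := expR _; nra.
Qed.

Lemma mgf_le_sum (d s : R) : `|s| <= d ->
  (mgf F0 s <= mgf F0 d + mgf F0 (- d))%E.
Proof.
move=> sd; have mE u := @measurable_expRM R u setT.
rewrite /mgf -ge0_integralD//.
apply: ge0_le_integral => //.
- exact: emeasurable_funD.
move=> x _; rewrite -EFinD lee_fin mulNr.
apply: le_trans (expR_norm_le (d * x)); rewrite ler_expR normrM.
apply: (le_trans (ler_norm _)); rewrite normrM ler_wpM2r//.
by rewrite (le_trans sd)// ler_norm.
Qed.

Lemma integral_mgf_affine (a b s : R) : 0 <= a -> 0 <= b ->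
  (\int[F0]_x (a%:E + b%:E * (expR (s * x))%:E) = a%:E + b%:E * mgf F0 s)%E.
Proof.
move=> a0 b0; have mE u := @measurable_expRM R u setT.
have E0 u x : (0 <= (expR (u * x))%:E :> \bar R)%E by rewrite lee_fin expR_ge0.
rewrite ge0_integralD//; last 2 first.
- by move=> x _; rewrite mule_ge0// lee_fin.
- by apply: emeasurable_funM; first exact: measurable_cst.
rewrite ge0_integralZl// integral_cst//.
by rewrite [X in (_ * X + _)%E](probability_setT F0) mule1.
Qed.

Section Bounds.
Variable d : R.
Hypotheses (d_gt0 : 0 < d) (find : (mgf F0 d < +oo)%E) (findN : (mgf F0 (- d) < +oo)%E).

Let phi s := fine (mgf F0 s).
Let K := phi d + phi (- d).

Let fin s : `|s| <= d -> (mgf F0 s < +oo)%E.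
Proof. by move=> sd; rewrite (le_lt_trans (mgf_le_sum sd))// lte_add_pinfty. Qed.

Let phiE s : `|s| <= d -> mgf F0 s = (phi s)%:E.
Proof. by move=> sd; rewrite /phi fine_mgfK// fin. Qed.

Let dd : `|d| <= d. Proof. by rewrite gtr0_norm. Qed.
Let dN : `|- d| <= d. Proof. by rewrite normrN gtr0_norm. Qed.

Let phi_gt0 s : `|s| <= d -> 0 < phi s.
Proof. by move=> sd; apply: fine_mgf_gt0; exact: fin. Qed.

Let K_gt0 : 0 < K. Proof. by rewrite addr_gt0// phi_gt0. Qed.

Let phi_le s : `|s| <= d -> phi s <= K.
Proof.
by move=> sd; rewrite -lee_fin EFinD -!phiE// mgf_le_sum.
Qed.

(* [exp y + a ^ 2 exp (- y) >= 2 a] by AM-GM, integrated with [a = 1 / K]. *)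
Let phi_ge s : `|s| <= d -> K^-1 <= phi s.
Proof.
move=> sd; have sN : `|- s| <= d by rewrite normrN.
have mE u := @measurable_expRM R u setT.
pose a := K^-1; have a0 : 0 < a by rewrite invr_gt0.
have : ((2 * a)%:E <= mgf F0 s + (a ^+ 2)%:E * mgf F0 (- s))%E.
  have E0 u x : (0 <= (expR (u * x))%:E :> \bar R)%E by rewrite lee_fin expR_ge0.
  rewrite -ge0_integralZl//; last by rewrite lee_fin sqr_ge0.
  rewrite -ge0_integralD//; last 2 first.
  - by move=> x _; rewrite mule_ge0// lee_fin sqr_ge0.
  - by apply: emeasurable_funM; first exact: measurable_cst.
  have -> : ((2 * a)%:E = \int[F0]_x (2 * a)%:E)%E.
    by rewrite integral_cst// [X in (_ * X)%E](probability_setT F0) mule1.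
  apply: ge0_le_integral => //.
  - by move=> x _; rewrite lee_fin mulr_ge0// ltW.
  - by apply: emeasurable_funD => //; apply: emeasurable_funM; first exact: measurable_cst.
  move=> x _; rewrite -EFinM -EFinD lee_fin mulNr expRN.
  have := expR_gt0 (s * x); set y := expR _ => y0.
  have : 0 <= (y - a) ^+ 2 / y by rewrite divr_ge0 ?sqr_ge0// ltW.
  have -> : (y - a) ^+ 2 / y = y + a ^+ 2 / y - 2 * a by field; rewrite gt_eqF.
  by rewrite subr_ge0.
rewrite !phiE// -EFinM -EFinD lee_fin => h.
have : a ^+ 2 * phi (- s) <= a.
  apply: (@le_trans _ _ (a ^+ 2 * K)); first by rewrite ler_wpM2l ?sqr_ge0// phi_le.
  by rewrite expr2 -mulrA /a mulVf ?mulr1// gt_eqF.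
by rewrite -/a; lra.
Qed.

(** The witness is phi (2 t) / phi t ^ 2 - 1. Integrating [expR_second_order] gives phi (2 t) + 1 <=
    2 phi t + C K, whence phi (2 t) - phi t ^ 2 <= C K; dividing, with phi t >= 1 / K, produces K ^
    3. *)
Lemma lr_second_moment (t : R) : 0 < t -> t <= d / 4 ->
  (mgf F0 t < +oo)%E /\
  exists l : R, [/\ 0 <= l, l <= 16 / d ^+ 2 * K ^+ 3 * t ^+ 2 &
    (\int[F0]_x ((lr F0 t x) ^+ 2)%:E = (1 + l)%:E)%E].
Proof.
move=> t0 td; have mE u := @measurable_expRM R u setT.
have E0 u x : (0 <= (expR (u * x))%:E :> \bar R)%E by rewrite lee_fin expR_ge0.
have td1 : `|t| <= d by rewrite gtr0_norm//; lra.
have td2 : `|2 * t| <= d by rewrite gtr0_norm ?mulr_gt0//; lra.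
split; first exact: fin.
pose C := 16 / d ^+ 2 * t ^+ 2.
have C0 : 0 <= C by rewrite mulr_ge0 ?sqr_ge0// divr_ge0// sqr_ge0.
have up : phi (2 * t) + 1 <= 2 * phi t + C * K.
  rewrite -lee_fin /K !EFinD !EFinM !EFinD -!phiE//.
  have -> : (mgf F0 (2 * t) + 1%:E =
      \int[F0]_x (1%:E + 1%:E * (expR (2 * t * x))%:E))%E.
    by rewrite integral_mgf_affine// mul1e addeC.
  have -> : (2%:E * mgf F0 t + C%:E * (mgf F0 d + mgf F0 (- d)) =
      \int[F0]_x ((0%:E + 2%:E * (expR (t * x))%:E) +
        C%:E * ((expR (d * x))%:E + (expR (- d * x))%:E)))%E.
    rewrite ge0_integralD//; first last.
    - by apply: emeasurable_funM; [exact: measurable_cst|exact: emeasurable_funD].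
    - by move=> x _; rewrite mule_ge0// adde_ge0.
    - apply: emeasurable_funD; first exact: measurable_cst.
      by apply: emeasurable_funM; first exact: measurable_cst.
    - by move=> x _; rewrite adde_ge0// mule_ge0.
    rewrite integral_mgf_affine// add0e; congr (_ + _)%E.
    rewrite ge0_integralZl//; last 2 first.
    - exact: emeasurable_funD.
    - by move=> x _; rewrite adde_ge0.
    by rewrite ge0_integralD.
  apply: ge0_le_integral => //.
  - by move=> x _; rewrite adde_ge0// mule_ge0.
  - apply: emeasurable_funD; first exact: measurable_cst.
    by apply: emeasurable_funM; first exact: measurable_cst.
  - apply: emeasurable_funD.
      apply: emeasurable_funD; first exact: measurable_cst.
      by apply: emeasurable_funM; first exact: measurable_cst.
    by apply: emeasurable_funM; [exact: measurable_cst|exact: emeasurable_funD].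
  move=> x _; rewrite -!(EFinM, EFinD) lee_fin.
  rewrite add0r mul1r [leLHS]addrC; exact: (expR_second_order x d_gt0 (ltW t0) td).
(* Cauchy-Schwarz, obtained by integrating (phi t - exp (t x))^2 >= 0. *)
have lo : phi t ^+ 2 <= phi (2 * t).
  rewrite -subr_ge0.
  have : ((2 * phi t)%:E * mgf F0 t <= (phi t ^+ 2)%:E + 1%:E * mgf F0 (2 * t))%E.
    rewrite -integral_mgf_affine ?sqr_ge0// -[leLHS]add0e -integral_mgf_affine//; last first.
      by rewrite mulr_ge0// ltW// phi_gt0.
    apply: ge0_le_integral => //.
    - by move=> x _; rewrite adde_ge0// mule_ge0// lee_fin mulr_ge0// ltW// phi_gt0.
    - apply: emeasurable_funD; first exact: measurable_cst.
      by apply: emeasurable_funM; first exact: measurable_cst.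
    - apply: emeasurable_funD; first exact: measurable_cst.
      by apply: emeasurable_funM; first exact: measurable_cst.
    move=> x _; rewrite -!EFinM -!EFinD lee_fin -[2 * t * x]mulrA expRM_natl.
    have := sqr_ge0 (phi t - expR (t * x)); rewrite sqrrB; lra.
  by rewrite !phiE// -!EFinM -EFinD lee_fin; nra.
exists (phi (2 * t) / phi t ^+ 2 - 1).
have p0 := phi_gt0 td1; have pp0 : 0 < phi t ^+ 2 by rewrite exprn_gt0.
split.
- by rewrite subr_ge0 ler_pdivlMr// mul1r.
- have h : phi (2 * t) - phi t ^+ 2 <= C * K by have := sqr_ge0 (phi t - 1); nra.
  have -> : phi (2 * t) / phi t ^+ 2 - 1 = (phi (2 * t) - phi t ^+ 2) / phi t ^+ 2.
    by field; rewrite gt_eqF.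
  rewrite ler_pdivrMr//; apply: (le_trans h).
  have : 1 <= K * phi t.
    by have := phi_ge td1; rewrite -[K^-1]mul1r ler_pdivrMr// mulrC.
  move=> K1; have K2 : 1 <= (K * phi t) ^+ 2 by exact: exprn_ege1.
  have -> : 16 / d ^+ 2 * K ^+ 3 * t ^+ 2 * phi t ^+ 2 = C * K * (K * phi t) ^+ 2.
    by rewrite /C; ring.
  by rewrite ler_peMr// mulr_ge0// ltW.
have -> : (1 + (phi (2 * t) / phi t ^+ 2 - 1))%:E =
    (0%:E + (phi t ^- 2)%:E * mgf F0 (2 * t))%E.
  by rewrite phiE// -EFinM -EFinD; congr EFin; ring.
rewrite -integral_mgf_affine//; last by rewrite invr_ge0 ltW.
apply: eq_integral => x _; rewrite (lrE (fin td1)) -EFinM -EFinD add0r.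
by rewrite expr_div_n -expRM_natl mulrC mulrA.
Qed.

End Bounds.

End MomentGeneratingFunction.

Lemma limn_einf_ge (R : realType) (u : (\bar R)^nat) (a : \bar R) :
  (\forall n \near \oo, (a <= u n)%E) -> (a <= limn_einf u)%E.
Proof.
move=> [N _ Nu]; rewrite limn_einf_lim; apply: lime_ge; first exact: is_cvg_einfs.
exists N => // n /= Nn; apply: le_ereal_inf_tmp => _ [k /= nk <-].
by apply: Nu => /=; exact: leq_trans nk.
Qed.

(** * Asymptotics of the lower bound *)

Section LowerBound.
Context {R : realType} (F0 : probability R R).

Lemma ln2_ge_half : 1 / 2 <= ln 2 :> R.
Proof.
have h : -1 < - (1 / 2) :> R by lra.
have := le_ln1Dx h.
have -> : 1 + - (1 / 2) = 2^-1 :> R by field.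
by rewrite lnV ?posrE// lerN2.
Qed.

(* [2 ^ L] is the least power of 2 above [m], so [L] is of order [ln m]. *)
Lemma sum_predictability_log (m : nat) : (0 < m)%N -> 1 <= ln m%:R :> R ->
  \sum_(k < m) predictability R (trunc_log 2 m).+1 k <= 25 * ln m%:R ^+ 2.
Proof.
case: m => // n _ ln1; set L := (trunc_log 2 n.+1).+1.
apply: (le_trans (sum_predictability_le R L n)).
set x := ln n.+1%:R in ln1 *.
have LX : L%:R <= 3 * x.
  have /andP[tl _] := trunc_log_bounds (isT : (1 < 2)%N) (isT : (0 < n.+1)%N).
  have : ln ((2 ^ trunc_log 2 n.+1)%:R) <= x.
    by rewrite /x ler_ln ?posrE ?ltr0n ?expn_gt0// ler_nat.
  rewrite natrX lnXn// -[ln _ *+ _]mulr_natl => h.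
  rewrite /L -natr1; set tl' := (trunc_log _ _)%:R in h *.
  have tl0 : 0 <= tl' by exact: ler0n.
  have : tl' * (1 / 2) <= tl' * ln 2 by rewrite ler_wpM2l// ln2_ge_half.
  lra.
have L0 : 0 <= L%:R :> R by exact: ler0n.
(* With L <= 3 x and 1 + x <= 2 x, the constant is 25 = 1 + 4 * 3 * 2. *)
have : 4 * L%:R * (1 + x) <= 4 * (3 * x) * (2 * x).
  apply: ler_pM; [by rewrite mulr_ge0|lra| |lra].
  by rewrite ler_wpM2l.
have : 1 <= x ^+ 2 by exact: exprn_ege1.
rewrite !expr2; lra.
Qed.

Lemma detection_impossible (theta : nat -> R) :
  (exists2 d : R, 0 < d & forall t : R, `|t| < d -> (mgf F0 t < +oo)%E) ->
  (forall m, 0 < theta m) ->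
  (fun m => theta m * ln (m%:R) * Num.sqrt (ln (ln (m%:R)))) @ \oo --> 0 ->
  forall T : forall m : nat, (nV m).-tuple R -> bool,
    (forall m, is_test (T m)) ->
    (1 <= limn_einf (fun m => risk F0 (theta m) (T m)))%E.
Proof.
move=> [d' d'0 fin] t0 tlim T mT.
pose d := d' / 2; have d0 : 0 < d by rewrite divr_gt0.
have find : (mgf F0 d < +oo)%E.
  by apply: fin; rewrite gtr0_norm// /d ltr_pdivrMr// ltr_pMr// ltr1n.
have findN : (mgf F0 (- d) < +oo)%E.
  by apply: fin; rewrite normrN gtr0_norm// /d ltr_pdivrMr// ltr_pMr// ltr1n.
pose C := 16 / d ^+ 2 * (fine (mgf F0 d) + fine (mgf F0 (- d))) ^+ 3.
have C0 : 0 <= C.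
  rewrite /C mulr_ge0 ?divr_ge0 ?sqr_ge0// exprn_ge0// addr_ge0//.
    by rewrite fine_ge0// mgf_ge0.
  by rewrite fine_ge0// mgf_ge0.
apply/lee_addgt0Pr => e e0; rewrite -leeBlDr//.
(* Half of e is the parameter of [risk_lower_bound], the other half pays for its error term. *)
pose f := e / 2; have f0 : 0 < f by rewrite divr_gt0.
(* If l A <= 1 / 2 then 1 / (1 - l A) - 1 <= 2 l A; with l A <= 2 f^2 this is at most 4 f^2, and
   dividing by 4 f leaves f. *)
pose g := Num.min (1 / 2) (2 * f ^+ 2).
have g0 : 0 < g by rewrite lt_min; apply/andP; split; rewrite ?mulr_gt0 ?exprn_gt0//; lra.
(* For theta ln m <= y, the caps give in turn theta <= d / 4, (theta ln m)^2 <= theta ln m, and 25 C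
   theta ln m <= g. *)
pose y := Num.min (d / 4) (Num.min 1 (g / (25 * C + 1))).
have C1 : 0 < 25 * C + 1 by rewrite ltr_wpDl// mulr_ge0.
have y0 : 0 < y by rewrite !lt_min ltr01 !divr_gt0.
apply: limn_einf_ge; near=> m.
have m0 : (0 < m)%N by near: m; exact: nbhs_infty_gt.
have mE : expR (expR 1) <= m%:R :> R by near: m; exact: nbhs_infty_ger.
have mR : 0 < m%:R :> R by rewrite ltr0n.
have lnE : expR 1 <= ln m%:R :> R by rewrite -ler_expR lnK// posrE.
have ln1 : 1 <= ln m%:R :> R by apply: le_trans lnE; rewrite -expR0 ler_expR.
have lnln1 : 1 <= ln (ln m%:R) :> R.
  by rewrite -ler_expR lnK// posrE (lt_le_trans _ ln1).
have s1 : 1 <= Num.sqrt (ln (ln m%:R)) :> R by rewrite -[leLHS]sqrtr1 ler_wsqrtr.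
have ty : `|theta m * ln m%:R * Num.sqrt (ln (ln m%:R))| < y.
  by near: m; move/cvgr0_norm_lt : tlim; apply.
have t_gt0 := t0 m; set t := theta m in t_gt0 ty *.
set x := ln m%:R in lnE ln1 lnln1 s1 ty *.
have x0 : 0 < x by exact: lt_le_trans ln1.
(* Dividing by the log log factor, which is at least 1 here, keeps the bound y. *)
have txy : t * x <= y.
  apply: le_trans (ltW ty); apply: le_trans (ler_norm _).
  by rewrite ler_peMr// mulr_ge0// ltW.
have td : t <= d / 4.
  apply: (@le_trans _ _ (t * x)); first by rewrite ler_peMr// ltW.
  by apply: (le_trans txy); rewrite ge_min lexx.
have [fint [l [l0 lC l2]]] := lr_second_moment d0 find findN t_gt0 td.
rewrite -/C in lC.
set L := (trunc_log 2 m).+1.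
have mL : (m.+1 <= 2 ^ L)%N by exact: trunc_log_ltn.
pose A := 25 * x ^+ 2.
have pA : \sum_(k < m) predictability R L k <= A by exact: sum_predictability_log.
have A0 : 0 <= A by rewrite mulr_ge0// sqr_ge0.
have lA : l * A <= g.
  apply: (@le_trans _ _ (25 * C * (t * x) ^+ 2)).
    have -> : 25 * C * (t * x) ^+ 2 = C * t ^+ 2 * A by rewrite /A; ring.
    by rewrite ler_wpM2r.
  have tx0 : 0 <= t * x by rewrite mulr_ge0// ltW.
  have y1 : t * x <= 1 by apply: (le_trans txy); rewrite !ge_min lexx orbT.
  have yg : t * x <= g / (25 * C + 1).
    by apply: (le_trans txy); rewrite !ge_min lexx !orbT.
  move: yg; rewrite ler_pdivlMr// => yg.
  have CC : 0 <= 25 * C by rewrite mulr_ge0.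
  apply: (@le_trans _ _ (25 * C * (t * x))).
    by rewrite ler_wpM2l// expr2 ler_piMl.
  by rewrite mulrC; nra.
have lA2 : l * A <= 1 / 2 by apply: (le_trans lA); rewrite ge_min lexx.
have lAf : l * A <= 2 * f ^+ 2 by apply: (le_trans lA); rewrite ge_min lexx orbT.
have lA1 : l * A < 1 by apply: (le_lt_trans lA2); lra.
have lA0 : 0 <= l * A by rewrite mulr_ge0.
apply: le_trans (risk_lower_bound fint l0 l2 (isT : (0 < L)%N) mL (mT m) pA lA1 f0).
rewrite -EFinB lee_fin.
have S1 : (1 - l * A)^-1 - 1 <= 4 * f ^+ 2.
  rewrite lerBlDr -[X in X <= _]mul1r ler_pdivrMr ?subr_gt0//.
  by clearbody A; nra.
have : ((1 - l * A)^-1 - 1) / (4 * f) <= f.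
  by rewrite ler_pdivrMr ?mulr_gt0//; move: S1; rewrite expr2; lra.
rewrite /f; lra.
Unshelve. all: by end_near. Qed.

End LowerBound.

Theorem theorem4p1 (R : realType) (F0 : probability R R)
  (nondeg : ~ exists c : R, F0 [set c] = 1%E)
  (mgf_fin : exists2 d : R, 0 < d & forall t : R, `|t| < d -> (mgf F0 t < +oo)%E)
  (theta : nat -> R) (theta_pos : forall m, 0 < theta m) :
  ((forall m, (mgf F0 (theta m) < +oo)%E) ->
   (fun m => theta m * Num.sqrt (ln (m%:R))) @ \oo --> +oo ->
   exists T : forall m : nat, (nV m).-tuple R -> bool,
     (forall m, is_test (T m)) /\
     (fun m => risk F0 (theta m) (T m)) @ \oo --> 0%E)
  /\
  ((fun m => theta m * ln (m%:R) * Num.sqrt (ln (ln (m%:R)))) @ \oo --> 0 ->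
   forall T : forall m : nat, (nV m).-tuple R -> bool,
     (forall m, is_test (T m)) ->
     (1 <= limn_einf (fun m => risk F0 (theta m) (T m)))%E).
Proof.
split; first exact: detection_possible.
exact: detection_impossible.
Qed.
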